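(* Let $(X,d,\mu)$ be a metric measure space with $\mu(X)=\infty$, and suppose that there exist a number $N>0$ (not necessarily integer) and constants $C_1>0$, $C_2>0$, not depending on $x$ and $r$, such that $$C_1r^N\le\mu B(x,r)\le C_2r^N\qquad\text{for all }x\in X,\ r>0.$$ Let $1<p<\infty$ and $0\le\lambda<N$. Then, with a constant $C>0$ not depending on $f$, $$\|Mf\|_{\mathcal{L}^{p,\lambda}(X)}\le C\,\|M^\#f\|_{\mathcal{L}^{p,\lambda}(X)}.$$
   Context: $(X,d,\mu)$ is a homogeneous metric measure space with quasidistance $d$ and measure $\mu$, $B(x,r)=\{y\in X:d(x,y)<r\}$, and $f$ denotes a function on $X$. The Morrey space $\mathcal{L}^{p,\lambda}(X)$ is defined by the norm $$\|f\|_{\mathcal{L}^{p,\lambda}(X)}=\sup_{x\in X,\,r>0}\left\{\frac1{r^\lambda}\int_{B(x,r)}|f(y)|^p\,d\mu(y)\right\}^{1/p}.$$ The maximal and sharp maximal operators are $$Mf(x)=\sup_{r>0}\frac{1}{\mu B(x,r)}\int_{B(x,r)}|f(y)|\,d\mu(y),\qquad M^\#f(x)=\sup_{r>0}\frac1{\mu B(x,r)}\int_{B(x,r)}|f(y)-f_{B(x,r)}|\,d\mu(y),$$ where $f_{B(x,r)}=\frac1{\mu B(x,r)}\int_{B(x,r)}f(y)\,d\mu(y)$.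
   Formalization: The formal theorem assumes that f is measurable with finite Morrey norm, i.e. f lies in L^{p,λ}(X); without this the claim fails for constant f = 1, where M#f = 0 but Mf = 1 has infinite Morrey norm since λ < N. *)

(* Defs.v *)
From HB Require Import structures.
From mathcomp Require Import all_boot all_order all_algebra.
From mathcomp Require Import all_classical all_reals all_analysis.

Set Implicit Arguments.
Unset Strict Implicit.
Unset Printing Implicit Defensive.

Import Order.TTheory GRing.Theory Num.Theory.
Import numFieldNormedType.Exports.

Local Open Scope classical_set_scope.
Local Open Scope ring_scope.

Record quasidistance (R : realType) (X : Type) (d : X -> X -> R) : Prop := {
  quasidistance_ge0 : forall x y, 0 <= d x y ;
  quasidistance_eq0 : forall x y, d x y = 0 <-> x = y ;
  quasidistance_sym : forall x y, d x y = d y x ;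
  quasidistance_triangle :
    exists K : R, forall x y z, d x z <= K * (d x y + d y z) }.

Definition qball (R : realType) (X : Type) (d : X -> X -> R) (x : X) (r : R) :
  set X := [set y | d x y < r].

(* No topology is fixed on X: the sigma-algebra of X is only required to
   contain the quasidistance balls. *)
Record homogeneous_space (R : realType) (disp : measure_display)
    (X : measurableType disp) (d : X -> X -> R)
    (mu : {measure set X -> \bar R}) : Prop := {
  homogeneous_quasidistance : quasidistance d ;
  homogeneous_measurable_ball : forall x r, measurable (qball d x r) ;
  homogeneous_doubling : exists c : R, forall x r, 0 < r ->
    (mu (qball d x (2 * r)) <= c%:E * mu (qball d x r))%E }.

Section operators.
Context (R : realType) (disp : measure_display) (X : measurableType disp).
Context (d : X -> X -> R) (mu : {measure set X -> \bar R}).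

Definition mean (B : set X) (f : X -> R) : R :=
  (fine (mu B))^-1 * \int[mu]_(y in B) f y.

Definition maximal (f : X -> R) (x : X) : \bar R :=
  ereal_sup [set ((fine (mu (qball d x r)))^-1%:E *
                  \int[mu]_(y in qball d x r) `|f y|%:E)%E | r in [set r | 0 < r]].

Definition sharp_maximal (f : X -> R) (x : X) : \bar R :=
  ereal_sup [set ((fine (mu (qball d x r)))^-1%:E *
                  \int[mu]_(y in qball d x r)
                     `|f y - mean (qball d x r) f|%:E)%E | r in [set r | 0 < r]].

(* Extended-real-valued g, because maximal functions may take the value +oo;
   the norm itself is +oo outside the Morrey space. *)
Definition morrey_norm (p lambda : R) (g : X -> \bar R) : \bar R :=
  ereal_sup [set (((xr.2 `^ lambda)^-1%:E *
                   \int[mu]_(y in qball d xr.1 xr.2) (`|g y| `^ p)) `^ p^-1)%E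
            | xr in [set xr : X * R | 0 < xr.2]].

Definition morrey_space (p lambda : R) : set (X -> R) :=
  [set f | measurable_fun setT f /\
           (morrey_norm p lambda (EFin \o f) < +oo)%E].

End operators.

(* Main.v *)
Require Import Defs.
From HB Require Import structures.
From mathcomp Require Import all_boot all_order all_algebra.
From mathcomp Require Import all_classical all_reals all_analysis.
From mathcomp Require Import measurable_realfun ring lra.

(** The proof is a good-lambda argument carried out on balls, and closed by the
Morrey growth itself rather than by an a priori bound on [M f].

Let [D] bound the Morrey norm of the sharp maximal function of [f], and put
[theta = (N - lambda) / p].  On a ball of radius [r] the sharp maximal function
dominates a multiple of the mean oscillation of [f] over that ball, so the
oscillation is at most a multiple of [D r^(-theta)] ([oscillation_decay]).  As
[lambda < N], these bounds are summable along the successive doubles of a ball,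
while the means of [f] over these doubles tend to zero because [f] belongs to
the Morrey space; telescoping bounds the mean of [|f|] over every ball of
radius [r] by a multiple of [D r^(-theta)] ([average_decay]).  Above that level,
a ball of radius [r] therefore only has to deal with averages over smaller
balls.

For such levels [t] and a ball [Q], [good_lambda] bounds the measure of the part
of [Q] where [M f > 2 t] by a small multiple, proportional to [g], of the measure
of the part of a dilate [kap Q] where [M f > c t], plus the measure of the part
of [Q] where the sharp maximal function exceeds [g t].  Multiplying by powers of the levels and summing over a geometric
sequence of levels gives an inequality between partial sums in which the dilated
ball carries one level less.  Dilating costs a factor [kap^N], which a small [g]
absorbs, so that induction on the number of levels ([level_sum_le]) gives a
bound that is uniform in that number, without knowing beforehand that the norm
of [M f] is finite.  Letting the number of levels grow bounds the integral of
[(M f)^p] over the ball ([maximal_morrey_ball]).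

The sigma-algebra is tied to no topology, so the maximal functions need not be
measurable and their integrals are lower integrals.  Their level sets are never
measured.  A countable family of balls, containing every ball within a ball of
comparable size ([engulfing_sequence]), provides instead two families of
countable unions of balls, [average_level] and [oscillation_level], which are
comparable with the level sets of [M f] and of the sharp maximal function
([maximal_gt], [oscillation_level_sharp]). *)

Import Order.TTheory GRing.Theory Num.Theory.
Import numFieldNormedType.Exports.
Local Open Scope classical_set_scope.
Local Open Scope ring_scope.

Set Implicit Arguments.
Unset Strict Implicit.
Unset Printing Implicit Defensive.

(** * Measure theory and real powers *)

(** The integral of a nonnegative function is a supremum over the simple
functions below it, hence monotone even on functions that are not measurable. *)
Lemma ge0_le_lower_integral d (T : measurableType d) (R : realType)
    (mu : {measure set T -> \bar R}) (D : set T) (f g : T -> \bar R) :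
  (forall x, D x -> (0 <= f x)%E) -> (forall x, D x -> (f x <= g x)%E) ->
  (\int[mu]_(x in D) f x <= \int[mu]_(x in D) g x)%E.
Proof.
move=> f0 fg; rewrite [leLHS]integral_mkcond [leRHS]integral_mkcond.
have r0 x : (0 <= (f \_ D) x)%E.
  by rewrite patchE; case: ifPn => // /set_mem; exact: f0.
have rfg x : ((f \_ D) x <= (g \_ D) x)%E.
  by rewrite !patchE; case: ifPn => // /set_mem; exact: fg.
rewrite !ge0_integralTE//; last by move=> x; apply: le_trans (rfg x).
apply: le_ereal_sup => _ [h hf <-]; exists h => //= x.
exact: le_trans (hf x) (rfg x).
Qed.

Lemma measure_seq_bigsetU d (T : measurableType d) (R : realType)
    (mu : {measure set T -> \bar R}) (I : eqType) (F : I -> set T) (s : seq I) :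
  (forall i, measurable (F i)) -> uniq s -> trivIset [set` s] F ->
  mu (\big[setU/set0]_(i <- s) F i) = (\sum_(i <- s) mu (F i))%E.
Proof.
move=> mF us tF; rewrite -[LHS]mul1e -integral_cst; last first.
  exact: bigsetU_measurable.
rewrite (@ge0_integral_bigsetU _ _ _ mu I F)//.
by apply: eq_bigr => i _; rewrite integral_cst// mul1e.
Qed.

Lemma measure_seq_subadditive d (T : measurableType d) (R : realType)
    (mu : {measure set T -> \bar R}) (I : eqType) (F : I -> set T) (s : seq I) :
  (forall i, measurable (F i)) ->
  (mu (\big[setU/set0]_(i <- s) F i) <= \sum_(i <- s) mu (F i))%E.
Proof.
move=> mF; elim: s => [|i s IH]; first by rewrite !big_nil measure0.
rewrite !big_cons; apply: le_trans (measureU2 _ _ _) _ => //.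
  exact: bigsetU_measurable.
exact: leeD2l.
Qed.

Lemma measure_subset d (T : measurableType d) (R : realType)
    (mu : {measure set T -> \bar R}) (A E : set T) :
  measurable A -> measurable E -> A `<=` E -> (mu A <= mu E)%E.
Proof. by move=> mA mE; apply: le_measure; rewrite inE. Qed.

(** Reduces a bound on a countable union to finite unions, to which a greedy
covering argument applies. *)
Lemma measure_bigcup_le_seq d (T : measurableType d) (R : realType)
    (m : {measure set T -> \bar R}) (A : set T) (F : nat -> set T)
    (P : set nat) (M : \bar R) :
  measurable A -> (forall n, measurable (F n)) ->
  (forall s : seq nat, (forall i, i \in s -> P i) ->
    (m (A `&` \big[setU/set0]_(i <- s) F i) <= M)%E) ->
  (m (A `&` \bigcup_(i in P) F i) <= M)%E.
Proof.
move=> mA mF AM.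
pose G n := A `&` \big[setU/set0]_(i <- [seq i <- iota 0 n | `[< P i >]]) F i.
have mG n : measurable (G n).
  by apply: measurableI => //; exact: bigsetU_measurable.
have GE : A `&` \bigcup_(i in P) F i = \bigcup_n G n.
  apply/seteqP; split=> [x [Ax [i Pi Fix]]|x [n _ [Ax]]].
    have iP : i \in [seq k <- iota 0 i.+1 | `[< P k >]].
      by rewrite mem_filter mem_iota add0n ltnSn; apply/andP; split => //; apply/asboolP.
    by exists i.+1 => //; split => //; rewrite -bigcup_seq; exists i.
  rewrite -bigcup_seq => -[i /=]; rewrite mem_filter => /andP[/asboolP Pi _] Fix.
  by split => //; exists i.
have cG : m (G n) @[n --> \oo] --> m (\bigcup_n G n).
  apply: nondecreasing_cvg_mu => //; first exact: bigcup_measurable.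
  move=> a b ab; apply/subsetPset; apply: setIS.
  rewrite -!bigcup_seq => x [i /=]; rewrite mem_filter mem_iota.
  move=> /andP[Pi /andP[_ ia]] Fix; exists i => //=.
  by rewrite mem_filter Pi mem_iota /= (leq_trans ia).
rewrite GE -(cvg_lim _ cG)//; apply: lime_le.
  by apply/cvg_ex; eexists; exact: cG.
apply: nearW => n; apply: AM => i; rewrite mem_filter => /andP[/asboolP].
by [].
Qed.

Lemma integral_weighted_indic d (T : measurableType d)
    (R : realType) (mu : {measure set T -> \bar R}) (S E : set T)
    (k : R) : measurable S -> measurable E -> 0 <= k ->
  (\int[mu]_(y in S) (k%:E * (\1_E y)%:E) = k%:E * mu (S `&` E))%E.
Proof.
move=> mS mE k0; rewrite ge0_integralZl ?lee_fin//.
- by rewrite integral_indic// setIC.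
- by apply/measurable_EFinP; exact: measurable_indic.
Qed.

Lemma measurable_weighted_indic d (T : measurableType d)
    (R : realType) (S E : set T) (k : R) : measurable S ->
  measurable E -> measurable_fun S (fun y => k%:E * (\1_E y)%:E)%E.
Proof.
move=> mS mE; apply: measurable_funeM; apply/measurable_EFinP.
exact: measurable_indic.
Qed.

Lemma powers_unbounded (R : realType) (b M : R) : 1 < b -> exists n, M <= b ^+ n.
Proof.
move=> b1; have h n : 1 + n%:R * (b - 1) <= b ^+ n.
  elim: n => [|n IH]; first by rewrite expr0 mul0r addr0.
  have n0 : 0 <= n%:R :> R by [].
  rewrite exprS -natr1.
  have : b * (1 + n%:R * (b - 1)) <= b * b ^+ n by rewrite ler_pM2l//; lra.
  have : 0 <= n%:R * ((b - 1) * (b - 1)) by rewrite mulr_ge0// mulr_ge0//; lra.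
  move: (b ^+ n) (n%:R) => u v; nra.
exists (Num.truncn (M / (b - 1))).+1; apply: le_trans (h _).
rewrite -[leLHS]add0r lerD// -ler_pdivrMr ?subr_gt0//.
by rewrite ltW// truncnS_gt.
Qed.

Lemma powR_gt1 (R : realType) (b x : R) : 1 < b -> 0 < x -> 1 < b `^ x.
Proof.
move=> b1 x0; have -> : (1 : R) = 1 `^ x by rewrite powR1.
by apply: gt0_ltr_powR; rewrite // nnegrE; lra.
Qed.

(** Below [e] the first term suffices; above it, [(u / e)^(p - 1) >= 1].  This
elementary substitute for Hoelder's inequality is optimized through [e]. *)
Lemma le_truncated_power (R : realType) (p e u : R) : 1 < p -> 0 < e -> 0 <= u ->
  u <= e + e `^ (1 - p) * u `^ p.
Proof.
move=> p1 e0 u0; have [ue|eu] := leP u e.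
  by rewrite -[leLHS]addr0 lerD// mulr_ge0// powR_ge0.
rewrite -[leLHS]add0r lerD// ?(ltW e0)// -opprB powRN mulrC.
rewrite ler_pdivlMr ?powR_gt0// -(@mulr_powRB1 _ u)//; last by lra.
by rewrite ler_wpM2l// ge0_ler_powR// ?nnegrE; lra.
Qed.

(** * Quasimetric balls and the Vitali covering lemma *)

Section ahlfors_regular.
Context (R : realType) (disp : measure_display) (X : measurableType disp).
Context (d : X -> X -> R) (mu : {measure set X -> \bar R}) (K N C1 C2 : R).
Hypothesis d0 : forall x, d x x = 0.
Hypothesis dC : forall x y, d x y = d y x.
Hypothesis K1 : 1 <= K.
Hypothesis dK : forall x y z, d x z <= K * (d x y + d y z).
Let B := qball d.
Let K0 : 0 < K. Proof. exact: lt_le_trans K1. Qed.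

Lemma qball_center x r : 0 < r -> B x r x.
Proof. by move=> r0; rewrite /B /qball/= d0. Qed.

Lemma subset_qball x r s : r <= s -> B x r `<=` B x s.
Proof. by move=> rs y; rewrite /B /qball/= => /lt_le_trans; apply. Qed.

Lemma qball_recenter x y r : B x r y -> B x r `<=` B y (2 * K * r).
Proof.
rewrite /B /qball/= => xy z /= xz.
apply: le_lt_trans (dK y x z) _; rewrite (dC y x) (mulrC 2) -mulrA.
by rewrite ltr_pM2l//; lra.
Qed.

Definition engulfing_factor : R := K * (1 + 2 * K).

Lemma engulfing_factor_gt2 : 2 < engulfing_factor.
Proof. by have := K1; rewrite /engulfing_factor; nra. Qed.

Lemma qball_engulf x r y s : r <= s -> B x r `&` B y s !=set0 ->
  B x r `<=` B y (engulfing_factor * s).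
Proof.
move=> rs [z]; rewrite /B /qball/= => -[xz yz] w /= xw.
have zw := dK z x w; have yw := dK y z w; rewrite (dC z x) in zw.
have s0 : K * (d x z + d x w) < K * (2 * s) by rewrite ltr_pM2l//; lra.
have : K * (d y z + d z w) < K * (s + K * (2 * s)).
  by rewrite ltr_pM2l//; lra.
have := K1; rewrite /engulfing_factor; nra.
Qed.

(** Greedy choice: keep a ball of largest radius, discard the balls that meet it
(its dilate contains them), and recurse. *)
Lemma vitali_seq (I : eqType) (c : I -> X) (rho : I -> R) (s : seq I) :
  (forall i, 0 < rho i) ->
  exists J : seq I, [/\ uniq J, {subset J <= s},
    trivIset [set` J] (fun i => B (c i) (rho i)) &
    forall i, i \in s -> exists2 j, j \in J &
      B (c i) (rho i) `<=` B (c j) (engulfing_factor * rho j)].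
Proof.
have K2 := engulfing_factor_gt2; move=> rho0.
elim: {s}(size s) {-2}s (leqnn (size s)) => [|n IH] s.
  by rewrite leqn0 => /nilP ->; exists [::]; split => // x y.
have [->|s_neq0] := eqVneq s [::]; first by exists [::]; split => // x y.
have [j js jmax] : exists2 j, j \in s & forall i, i \in s -> rho i <= rho j.
  elim: s s_neq0 {n IH} => // a s IHs _.
  have [->|/IHs[j js jmax]] := eqVneq s [::].
    by exists a; rewrite ?mem_head// => i; rewrite inE => /eqP ->.
  have [aj|ja] := leP (rho a) (rho j).
    exists j; first by rewrite inE js orbT.
    by move=> i; rewrite inE => /orP[/eqP ->|/jmax].
  exists a; first exact: mem_head.
  move=> i; rewrite inE => /orP[/eqP ->//|/jmax ij].
  exact: le_trans ij (ltW ja).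
pose meets i := `[< B (c i) (rho i) `&` B (c j) (rho j) !=set0 >].
pose s' := [seq i <- s | (i != j) && ~~ meets i].
move=> sn; have s'n : (size s' <= n)%N.
  rewrite -ltnS; apply: leq_trans sn; rewrite size_filter -(count_predC (pred1 j) s).
  rewrite -addn1 addnC leq_add//; last first.
    by apply: sub_count => i /andP[].
  by rewrite -has_count; apply/hasP; exists j => /=.
have [J [uJ Js tJ cJ]] := IH _ s'n.
exists (j :: J); split => //=.
- rewrite uJ andbT; apply/negP => /Js; rewrite mem_filter eqxx//.
- move=> i; rewrite inE => /orP[/eqP ->//|/Js]; rewrite mem_filter.
  by case/andP.
- have jJ i : i \in J -> ~ (B (c i) (rho i) `&` B (c j) (rho j) !=set0).
    by move=> /Js; rewrite mem_filter => /andP[/andP[_ /asboolPn]].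
  move=> a b /=; rewrite !inE => /orP[/eqP ->|aJ] /orP[/eqP ->|bJ] //.
  + by rewrite setIC => /(jJ _ bJ).
  + by move/(jJ _ aJ).
  + exact: tJ.
move=> i iS; have [ij|ij] := eqVneq i j.
  exists j; rewrite ?mem_head// ij; apply: subset_qball.
  by have := rho0 j; nra.
case: (pselect (B (c i) (rho i) `&` B (c j) (rho j) !=set0)) => meet.
  exists j; rewrite ?mem_head//; exact: qball_engulf (jmax _ iS) meet.
have [|k kJ ik] := cJ i.
  by rewrite mem_filter ij iS andbT; apply/asboolPn.
by exists k; rewrite // inE kJ orbT.
Qed.

(** * Regular measures and countable families of balls *)

Hypothesis mB : forall x r, measurable (B x r).
Hypothesis N0 : 0 < N.
Hypothesis C10 : 0 < C1.
Hypothesis C20 : 0 < C2.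
Hypothesis growth : forall (x : X) (r : R), 0 < r ->
  ((C1 * r `^ N)%:E <= mu (B x r))%E /\ (mu (B x r) <= (C2 * r `^ N)%:E)%E.

Lemma measure_qball_gt0 x (r : R) : 0 < r -> (0 < mu (B x r))%E.
Proof.
move=> r0; apply: lt_le_trans (growth x r0).1.
by rewrite lte_fin mulr_gt0// powR_gt0.
Qed.

Lemma measure_qball_fin x (r : R) : 0 < r -> mu (B x r) \is a fin_num.
Proof.
by move=> r0; rewrite ge0_fin_numE// (le_lt_trans (growth x r0).2)// ltry.
Qed.

Definition dilation_factor (s : R) : R := C2 / C1 * s `^ N.

Lemma dilation_factor_gt0 s : 0 < s -> 0 < dilation_factor s.
Proof. by move=> s0; rewrite mulr_gt0 ?powR_gt0// divr_gt0. Qed.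

(** The two centres are unrelated: in a regular space balls of equal radius have
comparable measures wherever they are. *)
Lemma measure_qball_dilate x y (r s : R) : 0 < r -> 0 < s ->
  (mu (B x (s * r)) <= (dilation_factor s)%:E * mu (B y r))%E.
Proof.
move=> r0 s0; apply: le_trans (growth x (mulr_gt0 s0 r0)).2 _.
apply: (@le_trans _ _ ((dilation_factor s)%:E * (C1 * r `^ N)%:E)%E).
  rewrite -EFinM lee_fin powRM ?(ltW s0) ?(ltW r0)// /dilation_factor.
  have -> // : C2 / C1 * s `^ N * (C1 * r `^ N) = C2 * (s `^ N * r `^ N).
  by field; exact: lt0r_neq0.
rewrite lee_wpmul2l// ?lee_fin ?(ltW (dilation_factor_gt0 s0))//.
exact: (growth y r0).1.
Qed.

(** Points at mutual distance [r] are the centres of disjoint balls of radius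
[r / (2 K)] inside a fixed ball; as each of these has measure at least a fixed
positive constant, their number is bounded and a maximal set of them is a net. *)
Lemma totally_bounded_qball x0 (S r : R) : 0 < S -> 0 < r ->
  exists l : seq X, forall y, B x0 S y -> exists2 z, z \in l & B y r z.
Proof.
move=> S0 r0; apply/not_existsP => noL.
have sep n : exists l : seq X, [/\ size l = n, uniq l,
    (forall a, a \in l -> B x0 S a) &
    (forall a b, a \in l -> b \in l -> a != b -> r <= d a b)].
  elim: n => [|n [l [sl ul lB lr]]]; first by exists [::].
  have [y [yB yl]] : exists y, B x0 S y /\ forall z, z \in l -> ~ B y r z.
    apply/not_existsP => h; apply: (noL l) => y yB.
    apply/not_exists2P => h'; apply: (h y); split => // z zl.
    by case: (h' z).
  have yr z : z \in l -> r <= d y z by move=> /yl/negP; rewrite -leNgt.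
  exists (y :: l); split.
  - by rewrite /= sl.
  - rewrite /= ul andbT; apply/negP => /yl; apply.
    exact: qball_center.
  - by move=> a; rewrite inE => /orP[/eqP ->//|/lB].
  - move=> a b; rewrite !inE => /orP[/eqP ->|al] /orP[/eqP ->|bl].
    + by rewrite eqxx.
    + by move=> _; exact: yr.
    + by move=> _; rewrite dC; exact: yr.
    + exact: lr.
(* two balls of this radius whose centres are at distance r are disjoint *)
pose q := r / (2 * K).
have q0 : 0 < q by rewrite divr_gt0// mulr_gt0.
pose S' := K * (S + q).
have S'0 : 0 < S' by rewrite mulr_gt0// addr_gt0.
have bnd n : n%:R * (C1 * q `^ N) <= C2 * S' `^ N.
  have [l [sl ul lB lr]] := sep n.
  rewrite -lee_fin; apply: le_trans (growth x0 S'0).2.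
  have tl : trivIset [set` l] (fun a => B a q).
    move=> a b /= al bl [w []]; rewrite /B /qball/= => aw bw.
    apply/eqP; apply: contraT => /(lr _ _ al bl).
    rewrite leNgt; apply: contraNT => _; apply: le_lt_trans (dK a w b) _.
    rewrite (_ : r = K * (2 * q)); last by rewrite /q; field; exact: lt0r_neq0.
    by rewrite ltr_pM2l// (dC w); lra.
  apply: (@le_trans _ _ (mu (\big[setU/set0]_(a <- l) B a q))).
    rewrite measure_seq_bigsetU// -sl -(mul1r (C1 * _)) mulrA mulr1.
    elim: (l) => [|a s IH]; first by rewrite mul0r big_nil.
    rewrite big_cons /= -addn1 natrD mulrDl mul1r addrC EFinD leeD//.
    exact: (growth a q0).1.
  apply: measure_subset => //; first exact: bigsetU_measurable.
  rewrite -bigcup_seq => w [a /= al]; rewrite /B /qball/= => aw.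
  apply: le_lt_trans (dK x0 a w) _; rewrite ltr_pM2l//.
  by have := lB _ al; rewrite /B /qball/=; lra.
have c0 : 0 < C1 * q `^ N by rewrite mulr_gt0// powR_gt0.
have := bnd (Num.truncn (C2 * S' `^ N / (C1 * q `^ N))).+1.
by rewrite leNgt -ltr_pdivrMr// truncnS_gt.
Qed.

Lemma dense_sequence (x0 : X) : exists z : nat -> X,
  forall y (r : R), 0 < r -> exists n, B y r (z n).
Proof.
have /choice[L LP] (mk : nat * nat) : exists l : seq X, forall y,
    B x0 mk.1.+1%:R y -> exists2 z, z \in l & B y mk.2.+1%:R^-1 z.
  exact: totally_bounded_qball.
exists (fun n => if unpickle n is Some (mk, i) then nth x0 (L mk) i else x0).
move=> y r r0; pose m := Num.truncn (d x0 y); pose k := Num.truncn r^-1.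
have [z zL yz] : exists2 z, z \in L (m, k) & B y k.+1%:R^-1 z.
  by apply: (LP (m, k)); rewrite /B /qball/= truncnS_gt.
exists (pickle ((m, k), index z (L (m, k)))); rewrite pickleK nth_index//.
move: yz; apply: subset_qball => /=.
by rewrite -[leRHS]invrK lef_pV2 ?posrE ?invr_gt0// ltW// truncnS_gt.
Qed.

(** Balls with centres in a dense sequence and rational radii. *)
Lemma engulfing_sequence (x0 : X) : exists (c : nat -> X) (rho : nat -> R),
  (forall n, 0 < rho n) /\ forall y (r : R), 0 < r -> exists n,
    B y r `<=` B (c n) (rho n) /\ rho n <= 3 * K * r.
Proof.
have [z zP] := dense_sequence x0.
pose idx n : nat * rat := odflt (0%N, 0%Q) (unpickle n).
pose rad n : R := ratr (idx n).2.
exists (fun n => z (idx n).1), (fun n => if 0 < rad n then rad n else 1).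
split => [n|y r r0]; first by case: ifPn.
have [i yi] := zP y r r0.
have Kr : 0 < K * r by rewrite mulr_gt0.
have : 2 * K * r < 3 * K * r by lra.
case/rat_in_itvoo => q /itvP qP; exists (pickle (i, q)).
rewrite /rad /idx pickleK /=; have q2 : 2 * K * r <= ratr q by rewrite qP.
have -> : 0 < (ratr q : R) by lra.
split; last by rewrite qP.
by apply: subset_trans (subset_qball q2); exact: qball_recenter.
Qed.

(** The weak (1,1) inequality for maximal averages over finitely many balls. *)
Lemma weak_type_seq (I : choiceType) (c : I -> X) (rho : I -> R) (s : seq I)
    (E : set X) (h : X -> \bar R) (t : R) :
  (forall i, 0 < rho i) -> measurable E -> measurable_fun E h ->
  (forall x, E x -> (0 <= h x)%E) -> 0 <= t ->
  (forall i, i \in s -> B (c i) (rho i) `<=` E) ->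
  (forall i, i \in s ->
     (t%:E * mu (B (c i) (rho i)) <= \int[mu]_(x in B (c i) (rho i)) h x)%E) ->
  (t%:E * mu (\big[setU/set0]_(i <- s) B (c i) (rho i)) <=
   (dilation_factor engulfing_factor)%:E * \int[mu]_(x in E) h x)%E.
Proof.
move=> rho0 mE mh h0 t0 sE st.
have kap0 : 0 < engulfing_factor by have := engulfing_factor_gt2; lra.
have D0 := ltW (dilation_factor_gt0 kap0).
have [J [uJ Js tJ cJ]] := vitali_seq c s rho0.
apply: (@le_trans _ _ (t%:E * \sum_(j <- J)
    ((dilation_factor engulfing_factor)%:E * mu (B (c j) (rho j))))%E).
  rewrite lee_wpmul2l// ?lee_fin//.
  apply: (@le_trans _ _
      (mu (\big[setU/set0]_(j <- J) B (c j) (engulfing_factor * rho j)))).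
    apply: measure_subset; try exact: bigsetU_measurable.
    rewrite -!bigcup_seq => x [i /= /cJ[j jJ ij] ix].
    by exists j => //; exact: ij.
  apply: le_trans (measure_seq_subadditive _ _ _) _ => //.
  by apply: lee_sum => j _; exact: measure_qball_dilate.
rewrite -ge0_sume_distrr// muleCA lee_wpmul2l ?lee_fin//.
rewrite ge0_sume_distrr//.
apply: (@le_trans _ _ (\sum_(j <- J) \int[mu]_(x in B (c j) (rho j)) h x)%E).
  by rewrite big_seq [leRHS]big_seq; apply: lee_sum => j /Js; exact: st.
have subE : \big[setU/set0]_(j <- J) B (c j) (rho j) `<=` E.
  by rewrite -bigcup_seq => x [j /= /Js/sE jE]; exact: jE.
rewrite -(@ge0_integral_bigsetU _ _ _ mu I (fun j => B (c j) (rho j)))//.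
- apply: ge0_subset_integral => //; exact: bigsetU_measurable.
- exact: measurable_funS mh.
- by move=> x /subE; exact: h0.
Qed.

(** * Mean deviations of a function *)

Section fixed_function.
Variable f : X -> R.
Hypothesis mf : measurable_fun setT f.

(** Comparing [f] with an arbitrary constant treats the integral of [|f|], which is
the case [a = 0], and the oscillation of [f] about its mean uniformly. *)
Definition deviation (E : set X) (a : R) : \bar R :=
  (\int[mu]_(y in E) `|f y - a|%:E)%E.

Lemma measurable_deviation (E : set X) a : measurable E ->
  measurable_fun E (fun y => `|f y - a|%:E).
Proof.
move=> mE; apply/measurable_EFinP; apply: measurableT_comp => //.
by apply: measurable_funB => //; exact: measurable_funS mf.
Qed.

Lemma deviation_ge0 (E : set X) a : (0 <= deviation E a)%E.
Proof. by apply: integral_ge0 => y _; rewrite lee_fin. Qed.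

Lemma deviation_subset (E E' : set X) a : measurable E -> measurable E' ->
  E `<=` E' -> (deviation E a <= deviation E' a)%E.
Proof.
move=> mE mE' EE'; apply: ge0_subset_integral => //.
exact: measurable_deviation.
Qed.

Lemma deviation_shift (E : set X) a b : measurable E ->
  (deviation E a <= deviation E b + `|a - b|%:E * mu E)%E.
Proof.
move=> mE; rewrite -integral_cst// -ge0_integralD//; try exact: measurable_deviation.
  apply: ge0_le_lower_integral => y _ /=; rewrite ?lee_fin//.
  have -> : f y - a = (f y - b) - (a - b) by lra.
  exact: ler_normB.
by move=> y _; rewrite lee_fin.
Qed.

Lemma deviation_dist (E : set X) a b : measurable E ->
  (`|a - b|%:E * mu E <= deviation E a + deviation E b)%E.
Proof.
move=> mE; rewrite -integral_cst// -ge0_integralD//; try exact: measurable_deviation.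
apply: ge0_le_lower_integral => y _ /=; rewrite -?EFinD ?lee_fin//.
have -> : a - b = (f y - b) - (f y - a) by lra.
by rewrite [leRHS]addrC ler_normB.
Qed.

(** The exponent [theta] at which averages over balls of radius [r] decay. *)
Definition morrey_decay (p lambda : R) : R := (N - lambda) / p.

(** The truncation level [r^(-theta)] in [le_truncated_power] balances its two
terms. *)
Lemma deviation_morrey (p lambda F : R) x (r : R) : 1 < p -> 0 <= F -> 0 < r ->
  (\int[mu]_(y in B x r) (`|(f y)%:E| `^ p) <= (F * r `^ lambda)%:E)%E ->
  (deviation (B x r) 0 <=
   ((1 + F / C1) * r `^ (- morrey_decay p lambda))%:E * mu (B x r))%E.
Proof.
move=> p1 F0 r0 hF; set th := morrey_decay p lambda.
have p0 : 0 < p by lra.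
have e0 : 0 < r `^ (- th) by exact: powR_gt0.
set e := r `^ (- th) in e0 *.
have mfp : measurable_fun (B x r) (fun y => (`|(f y)%:E| `^ p)%E).
  apply: (measurableT_comp (measurable_poweR _)).
  apply: measurableT_comp => //; apply/measurable_EFinP.
  exact: measurable_funS mf.
apply: (@le_trans _ _ (\int[mu]_(y in B x r)
    (e%:E + (e `^ (1 - p))%:E * `|(f y)%:E| `^ p))%E).
  apply: ge0_le_lower_integral => y _ /=; rewrite ?lee_fin// subr0.
  exact: le_truncated_power.
rewrite ge0_integralD//; last 3 first.
- by move=> y _; rewrite lee_fin ltW.
- by move=> y _; rewrite mule_ge0// ?poweR_ge0// lee_fin powR_ge0.
- by apply: measurable_funeM.
rewrite (integral_cst _ _ e%:E)// ge0_integralZl//; last first.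
- by rewrite lee_fin powR_ge0.
- by move=> y _; exact: poweR_ge0.
rewrite mulrDl mul1r EFinD ge0_muleDl ?lee_fin ?(ltW e0)//; last first.
  by rewrite !mulr_ge0// ?invr_ge0 ltW.
rewrite leeD2l//; apply: le_trans (lee_wpmul2l _ hF) _.
  by rewrite lee_fin powR_ge0.
apply: (@le_trans _ _ ((F / C1 * e)%:E * (C1 * r `^ N)%:E)%E); last first.
  rewrite lee_wpmul2l ?lee_fin//; last exact: (growth x r0).1.
  by rewrite !mulr_ge0// ?invr_ge0 ltW.
rewrite -!EFinM lee_fin.
have -> : F / C1 * e * (C1 * r `^ N) = F * (e * r `^ N).
  by field; rewrite gt_eqF.
rewrite mulrCA; apply: ler_wpM2l => //.
have rn0 : r != 0 by rewrite gt_eqF.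
rewrite -powRrM -!powRD ?rn0 ?implybT//.
rewrite (_ : - th * (1 - p) + lambda = - th + N)//.
by rewrite /th /morrey_decay; field; rewrite gt_eqF.
Qed.

Hypothesis f_locally_integrable : forall x (r : R), 0 < r ->
  (deviation (B x r) 0 < +oo)%E.

Lemma deviation_qball_fin x (r : R) a : 0 < r ->
  deviation (B x r) a \is a fin_num.
Proof.
move=> r0; rewrite ge0_fin_numE ?deviation_ge0//.
apply: le_lt_trans (deviation_shift a 0 (mB x r)) _.
apply: lte_add_pinfty; first exact: f_locally_integrable.
by rewrite -(fineK (measure_qball_fin x r0)) -EFinM ltry.
Qed.

Lemma integrable_qball x (r : R) a : 0 < r ->
  mu.-integrable (B x r) (EFin \o (fun y => f y - a)).
Proof.
move=> r0; apply/integrableP; split.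
  apply/measurable_EFinP; apply: measurable_funB => //.
  exact: measurable_funS mf.
by have := deviation_qball_fin x a r0; rewrite ge0_fin_numE// deviation_ge0.
Qed.

Lemma mean_deviation x (r : R) a : 0 < r ->
  (`|mean mu (B x r) f - a|%:E * mu (B x r) <= deviation (B x r) a)%E.
Proof.
move=> r0; have m0 := measure_qball_gt0 x r0.
have mfin := measure_qball_fin x r0.
have m0' : 0 < fine (mu (B x r)) by rewrite fine_gt0// m0 -ge0_fin_numE.
have fi : mu.-integrable (B x r) (EFin \o f).
  by have := integrable_qball x 0 r0; under [X in _ \o X]eq_fun do rewrite subr0.
have ci : mu.-integrable (B x r) (EFin \o (cst a)).
  apply/integrableP; split; first by apply/measurable_EFinP; exact: measurable_cst.
  under eq_integral do rewrite /=.
  by rewrite (integral_cst _ _ `|a|%:E)// -(fineK mfin) -EFinM ltry.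
have -> : mean mu (B x r) f - a =
    (fine (mu (B x r)))^-1 * \int[mu]_(y in B x r) (f y - a).
  rewrite RintegralB// Rintegral_cst// mulrBr /mean; congr (_ - _).
  by rewrite mulrCA mulVf ?mulr1// gt_eqF.
rewrite -{2}(fineK mfin) -EFinM normrM gtr0_norm ?invr_gt0//.
rewrite mulrAC mulVf ?gt_eqF// mul1r EFin_normr_Rintegral//.
  exact: le_abse_integral (measurable_int _ (integrable_qball x a r0)).
exact: integrable_qball.
Qed.

(** Lets the mean over one ball be replaced by that over a comparable one in an
oscillation. *)
Lemma mean_quasi_optimal x (r : R) a : 0 < r ->
  (deviation (B x r) (mean mu (B x r) f) <= 2%:E * deviation (B x r) a)%E.
Proof.
move=> r0; apply: le_trans (deviation_shift _ a (mB x r)) _.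
rewrite (_ : 2%:E = (1 + 1)%:E :> \bar R)// EFinD ge0_muleDl// mul1e.
by rewrite leeD2l// mean_deviation.
Qed.

(** * Measurable substitutes for level sets of averages *)

Variables (c : nat -> X) (rho : nat -> R).
Hypothesis rho_gt0 : forall n, 0 < rho n.
Hypothesis engulfs : forall y (r : R), 0 < r -> exists n,
  B y r `<=` B (c n) (rho n) /\ rho n <= 3 * K * r.
Let ball n := B (c n) (rho n).

(** A countable union of balls, hence measurable, that stands for the set where the
maximal function attached to the averages of [a] exceeds [t]. *)
Definition superlevel (a : set X -> \bar R) (t : R) : set X :=
  \bigcup_(n in [set n | (t%:E * mu (ball n) < a (ball n))%E]) ball n.

Lemma measurable_superlevel a t : measurable (superlevel a t).
Proof. by apply: bigcup_measurable => n _; exact: mB. Qed.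

(** The loss in averages when a ball is replaced by a member of the family that
contains it. *)
Definition engulfing_cost : R := dilation_factor (3 * K).

Lemma engulfing_cost_gt0 : 0 < engulfing_cost.
Proof. by apply: dilation_factor_gt0; rewrite mulr_gt0. Qed.

Lemma engulfs_measure y (r : R) : 0 < r -> exists n,
  B y r `<=` ball n /\ (mu (ball n) <= engulfing_cost%:E * mu (B y r))%E.
Proof.
move=> r0; have [n [yn rn]] := engulfs y r0; exists n; split => //.
apply: (@le_trans _ _ (mu (B (c n) (3 * K * r)))).
  by apply: measure_subset; [exact: mB|exact: mB|exact: subset_qball].
by apply: measure_qball_dilate => //; rewrite mulr_gt0.
Qed.

Definition average_level := superlevel (deviation^~ 0).
Definition oscillation_level := superlevel (fun E => deviation E (mean mu E f)).

Lemma qball_sub_average_level y (r t : R) : 0 < r -> 0 <= t ->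
  (t%:E * mu (B y r) < deviation (B y r) 0)%E ->
  B y r `<=` average_level (t / engulfing_cost).
Proof.
move=> r0 t0 ht; have [n [yn mn]] := engulfs_measure y r0.
apply: (subset_trans yn); apply: bigcup_sup => /=.
have A0 := engulfing_cost_gt0.
apply: (@le_lt_trans _ _ (t%:E * mu (B y r))%E).
  rewrite EFinM -muleA; apply: lee_wpmul2l; first by rewrite lee_fin.
  rewrite muleC lee_pdivrMr//.
  by rewrite muleC.
exact: lt_le_trans ht (deviation_subset _ (mB _ _) (mB _ _) yn).
Qed.

Let kap := engulfing_factor.
Let kap_gt2 : 2 < kap. Proof. exact: engulfing_factor_gt2. Qed.
Let kap_gt0 : 0 < kap. Proof. by apply: lt_trans kap_gt2. Qed.

(** Dilate the ball repeatedly as long as its average exceeds [t]; the process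
stops because averages over balls of radius at least [R0] do not. *)
Lemma stopping_radius x (r R0 t : R) : 0 < r ->
  (forall y (s : R), R0 <= s -> (deviation (B y s) 0 <= t%:E * mu (B y s))%E) ->
  (t%:E * mu (B x r) < deviation (B x r) 0)%E ->
  exists s : R, [/\ r <= s, s < R0, (t%:E * mu (B x s) < deviation (B x s) 0)%E &
    (deviation (B x (kap * s)) 0 <= t%:E * mu (B x (kap * s)))%E].
Proof.
move=> r0 large.
have [n] : exists n, R0 <= kap ^+ n * r.
  have kap_gt1 : 1 < kap by have := kap_gt2; lra.
  have [n hn] := powers_unbounded (R0 / r) kap_gt1.
  by exists n; rewrite -ler_pdivrMr.
elim: n r r0 => [|n IH] r r0.
  by rewrite expr0 mul1r => /(large x); rewrite leNgt => /negbTE ->.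
move=> Rn ht.
have rR : r < R0 by rewrite ltNge; apply/negP => /(large x); rewrite leNgt ht.
have [small|big] := leP (deviation (B x (kap * r)) 0) (t%:E * mu (B x (kap * r)))%E.
  by exists r; split.
case: (IH (kap * r) _ _ big) => [||s [rs sR hs ks]].
- by rewrite mulr_gt0.
- by rewrite mulrA -exprSr.
by exists s; split => //; apply: le_trans rs; have := kap_gt2; nra.
Qed.

(** * The local good-lambda inequality *)

Definition good_lambda_factor : R :=
  2 * engulfing_cost * dilation_factor kap ^+ 2.

Lemma good_lambda_factor_gt0 : 0 < good_lambda_factor.
Proof.
have A0 := engulfing_cost_gt0; have D0 := dilation_factor_gt0 kap_gt0.
by rewrite /good_lambda_factor; apply: mulr_gt0; [apply: mulr_gt0|apply: exprn_gt0].
Qed.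

(** The Calderon-Zygmund step on one stopping ball.  If some point of the union
escapes [S], then [f] oscillates around the ball by at most a multiple of [g t],
and its mean [m] there is at most [3/2 t] in absolute value, because the dilated
ball has average at most [t].  So the balls with average above [2 t] still have
mean deviation from [m] at least [t / 2], and the weak type inequality for
[f - m] makes their union small. *)
Lemma good_lambda_local y (r t g : R) (s : seq nat) (S : set X) :
  0 < r -> 0 < t -> 0 < g -> engulfing_cost * g <= 2^-1 ->
  (deviation (B y (kap * r)) 0 <= t%:E * mu (B y (kap * r)))%E ->
  (forall i, i \in s -> ball i `<=` B y (kap * r)) ->
  (forall i, i \in s -> ((2 * t)%:E * mu (ball i) < deviation (ball i) 0)%E) ->
  S = oscillation_level (g * t) ->
  (mu ((\big[setU/set0]_(i <- s) ball i) `\` S) <=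
   (good_lambda_factor * g)%:E * mu (B y r))%E.
Proof.
move=> r0 t0 g0 small stop sE big SE; have A0 := engulfing_cost_gt0.
set U := \big[setU/set0]_(i <- s) ball i; set E := B y (kap * r).
have kr0 : 0 < kap * r by rewrite mulr_gt0.
have D0 := dilation_factor_gt0 kap_gt0.
have mU : measurable U by apply: bigsetU_measurable => i _; exact: mB.
have mS : measurable S by rewrite SE; exact: measurable_superlevel.
have [[z [Uz nSz]]|empty] := pselect ((U `\` S) !=set0); last first.
  rewrite (_ : U `\` S = set0) ?measure0; last first.
    by apply/eqP/negPn/negP => /set0P.
  by rewrite mule_ge0// lee_fin mulr_ge0// ltW// good_lambda_factor_gt0.
have UE : U `<=` E.
  by rewrite /U -bigcup_seq => x [i /= si]; exact: sE.
have [n [En mn]] := engulfs_measure y kr0.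
set m := mean mu (ball n) f.
have osc : (deviation (ball n) m <= (g * t)%:E * mu (ball n))%E.
  rewrite leNgt; apply/negP => hn; apply: nSz; rewrite SE; exists n => //.
  exact/En/UE.
have oscE : (deviation E m <= (engulfing_cost * g * t)%:E * mu E)%E.
  apply: le_trans (deviation_subset _ (mB _ _) (mB _ _) En) _.
  apply: le_trans osc _; apply: le_trans (lee_wpmul2l _ mn) _.
    by rewrite lee_fin ltW// mulr_gt0.
  by rewrite muleA -EFinM (mulrC (g * t)) mulrA.
have egt0 : 0 <= engulfing_cost * g * t by apply/ltW/mulr_gt0 => //; apply: mulr_gt0.
have muE0 : (0 < mu E)%E by exact: measure_qball_gt0.
have muEf : mu E \is a fin_num by exact: measure_qball_fin.
have m_small : `|m| <= 3 / 2 * t.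
  have : (`|m - 0|%:E * mu E <= (3 / 2 * t)%:E * mu E)%E.
    apply: le_trans (deviation_dist _ _ (mB _ _)) _.
    apply: le_trans (leeD oscE stop) _.
    rewrite -ge0_muleDl ?lee_fin ?egt0 ?(ltW t0)//.
    by rewrite lee_wpmul2r// lee_fin; nra.
  by rewrite subr0 lee_pmul2r// lee_fin.
have dev_i i : i \in s -> ((t / 2)%:E * mu (ball i) <= deviation (ball i) m)%E.
  move=> si; have := lt_le_trans (big i si) (deviation_shift 0 m (mB _ _)).
  rewrite -(fineK (measure_qball_fin (c i) (rho_gt0 i))).
  rewrite -(fineK (deviation_qball_fin (c i) m (rho_gt0 i))).
  have : 0 <= fine (mu (ball i)) by exact: fine_ge0.
  rewrite -!EFinM -EFinD lte_fin lee_fin sub0r normrN.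
  move: (fine _) (fine _) => a b *; nra.
have weak : ((t / 2)%:E * mu U <= (dilation_factor kap)%:E * deviation E m)%E.
  apply: weak_type_seq => //; last by rewrite divr_ge0// ltW.
    exact: mB.
  exact: (measurable_deviation _ (mB _ _)).
have ED : (mu E <= (dilation_factor kap)%:E * mu (B y r))%E.
  exact: measure_qball_dilate.
apply: (@le_trans _ _ (mu U)).
  by apply: measure_subset => //; exact: measurableD.
have t2 : (0 < (t / 2)%:E)%E by rewrite lte_fin divr_gt0.
rewrite -(lee_pmul2l _ t2)//; apply: le_trans weak _.
apply: le_trans (lee_wpmul2l _ oscE) _; first by rewrite lee_fin ltW.
apply: (@le_trans _ _ ((dilation_factor kap)%:E *
   ((engulfing_cost * g * t)%:E * ((dilation_factor kap)%:E * mu (B y r))))%E).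
  by rewrite !lee_wpmul2l// lee_fin// ltW.
rewrite !muleA -!EFinM /good_lambda_factor.
rewrite [leRHS](_ : _ = ((dilation_factor kap * (engulfing_cost * g * t)
  * dilation_factor kap)%:E * mu (B y r))%E)//.
by congr (_%:E * _)%E; field.
Qed.

(** Enlarge the balls with average above [2 t] that meet [B x0 r] to stopping balls
for the level [t] and select disjoint ones by Vitali's lemma.  The selected balls
lie in a slightly lower average level and, having radius less than [R0 <= r], in
a fixed dilate of [B x0 r]; their dilates carry the local estimate. *)
Lemma good_lambda x0 (r R0 t g : R) :
  R0 <= r -> 0 < t -> 0 < g -> engulfing_cost * g <= 2^-1 ->
  (forall y (s : R), R0 <= s -> (deviation (B y s) 0 <= t%:E * mu (B y s))%E) ->
  (mu (B x0 r `&` average_level (2 * t)) <=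
   (good_lambda_factor * g)%:E *
     mu (B x0 (kap * r) `&` average_level (t / engulfing_cost)) +
   mu (B x0 r `&` oscillation_level (g * t)))%E.
Proof.
move=> Rr t0 g0 small large; set S := oscillation_level _.
have mS : measurable S by exact: measurable_superlevel.
have mA u : measurable (average_level u) by exact: measurable_superlevel.
apply: (@le_trans _ _ (mu ((B x0 r `\` S) `&` average_level (2 * t)) +
    mu (B x0 r `&` S))%E).
  apply: le_trans (measureU2 _ _ _).
  - apply: measure_subset; first by apply: measurableI.
      by apply: measurableU; apply: measurableI => //; exact: measurableD.
    move=> x [Bx Ax]; have [Sx|nSx] := pselect (S x); first by right.
    by left; split.
  - by apply: measurableI => //; exact: measurableD.
  - exact: measurableI.
apply: leeD2r; apply: measure_bigcup_le_seq => [|n|s sP].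
- exact: measurableD.
- exact: mB.
pose s' := [seq i <- s | `[< ball i `&` B x0 r !=set0 >]].
have /choice[sr srP] i : exists q : R, 0 < q /\ (i \in s' ->
    [/\ rho i <= q, q < R0, (t%:E * mu (B (c i) q) < deviation (B (c i) q) 0)%E &
    (deviation (B (c i) (kap * q)) 0 <= t%:E * mu (B (c i) (kap * q)))%E]).
  have [is'|] := boolP (i \in s'); last by exists 1.
  case: (@stopping_radius (c i) (rho i) R0 t) => // [|q [iq qR hq kq]].
    apply: le_lt_trans (sP i _); last by move: is'; rewrite mem_filter => /andP[].
    by apply: lee_wpmul2r => //; rewrite lee_fin; lra.
  by exists q; split => //; apply: lt_le_trans iq.
have sr0 i : 0 < sr i := (srP i).1.
have [J [uJ Js tJ cJ]] := vitali_seq c s' sr0.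
pose sJ j := [seq i <- s' | `[< ball i `<=` B (c j) (kap * sr j) >]].
pose G j := (\big[setU/set0]_(i <- sJ j) ball i) `\` S.
have mG j : measurable (G j).
  by apply: measurableD => //; apply: bigsetU_measurable => i _; exact: mB.
apply: (@le_trans _ _ (mu (\big[setU/set0]_(j <- J) G j))).
  apply: measure_subset.
  - apply: measurableI; first exact: measurableD.
    by apply: bigsetU_measurable => i _; exact: mB.
  - exact: bigsetU_measurable.
  rewrite -!bigcup_seq => x [[Bx nSx] [i /= si ix]].
  have is' : i \in s' by rewrite mem_filter si andbT; apply/asboolP; exists x.
  have [j jJ ij] := cJ i is'; exists j => //; split => //.
  rewrite -bigcup_seq; exists i => //=; rewrite mem_filter is' andbT.
  apply/asboolP; apply: subset_trans ij.
  by apply: subset_qball; have [_ /(_ is')[]] := srP i.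
apply: le_trans (measure_seq_subadditive _ _ mG) _.
have gl0 : 0 <= good_lambda_factor * g.
  by rewrite mulr_ge0// ltW// good_lambda_factor_gt0.
apply: (@le_trans _ _ (\sum_(j <- J) (good_lambda_factor * g)%:E *
    mu (B (c j) (sr j)))%E).
  rewrite big_seq [leRHS]big_seq; apply: lee_sum => j /Js js'.
  have [_ /(_ js')[_ _ _ kq]] := srP j.
  apply: (good_lambda_local (sr0 j) t0 g0 small kq) => // i.
  - by rewrite mem_filter => /andP[/asboolP].
  - by rewrite !mem_filter => /and3P[_ _]; exact: sP.
rewrite -ge0_sume_distrr//; apply: lee_wpmul2l; first by rewrite lee_fin.
rewrite -(@measure_seq_bigsetU _ _ _ mu _ (fun j => B (c j) (sr j)))//.
apply: measure_subset; [exact: bigsetU_measurable|exact: measurableI|].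
rewrite -bigcup_seq => x [j /= /Js js' jx].
have [_ /(_ js')[rq qR hq _]] := srP j.
split; last by apply: qball_sub_average_level hq _ jx; [|exact: ltW].
suff : B x0 (kap * r) x by [].
apply: qball_engulf jx; first by apply: le_trans Rr; exact: ltW.
move: js'; rewrite mem_filter => /andP[/asboolP[z [jz x0z]] _].
by exists z; split => //; apply: subset_qball jz.
Qed.

(** * Comparison with the maximal functions *)

Lemma maximal_gt x (s : R) : 0 <= s -> (s%:E < maximal d mu f x)%E ->
  average_level (s / engulfing_cost) x.
Proof.
move=> s0 /ereal_sup_gt[_ [r /= r0 <-] sr].
have r0' : 0 < r by [].
apply: (qball_sub_average_level r0' s0) (qball_center x r0').
have m0 := measure_qball_gt0 x r0'; have mfin := measure_qball_fin x r0'.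
have m0' : 0 < fine (mu (B x r)) by rewrite fine_gt0// m0 -ge0_fin_numE.
move: sr; rewrite /deviation; under eq_integral do rewrite -(subr0 (f _)).
rewrite -/(deviation _ 0) -(fineK mfin).
rewrite -(fineK (deviation_qball_fin x 0 r0')) -!EFinM !lte_fin.
by rewrite ltr_pdivlMl// mulrC.
Qed.

Definition sharp_cost : R := 2 * dilation_factor (2 * K).

Lemma sharp_cost_gt0 : 0 < sharp_cost.
Proof. by rewrite mulr_gt0// dilation_factor_gt0// mulr_gt0. Qed.

(** The ball lies in a ball centred at [y] of comparable measure, whose mean is
almost as good a constant as the mean over the ball itself. *)
Lemma sharp_maximal_ge x (r s : R) y : 0 < r -> 0 <= s -> B x r y ->
  (s%:E * mu (B x r) <= deviation (B x r) (mean mu (B x r) f))%E ->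
  ((s / sharp_cost)%:E <= sharp_maximal d mu f y)%E.
Proof.
move=> r0 s0 xy hs; have sc0 := sharp_cost_gt0.
have q0 : 0 < 2 * K * r by rewrite !mulr_gt0.
pose Q := B y (2 * K * r).
have mufin := measure_qball_fin y q0; have mu0 := measure_qball_gt0 y q0.
have mu0' : 0 < fine (mu Q) by rewrite fine_gt0// mu0 -ge0_fin_numE.
apply: le_trans (ereal_sup_ubound _); last by exists (2 * K * r).
have BQ : B x r `<=` Q by exact: qball_recenter.
have K20 : 0 < 2 * K by rewrite mulr_gt0.
have QB : (mu Q <= (dilation_factor (2 * K))%:E * mu (B x r))%E.
  exact: measure_qball_dilate.
have : ((s / sharp_cost)%:E * mu Q <= deviation Q (mean mu Q f))%E.
  rewrite -(@lee_pmul2l _ 2%:E)//.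
  apply: le_trans (lee_wpmul2l _ (deviation_subset _ (mB _ _) (mB _ _) BQ)) => //.
  apply: le_trans (mean_quasi_optimal x _ r0); apply: le_trans hs.
  rewrite muleA -EFinM.
  apply: le_trans (lee_wpmul2l _ QB) _.
    by rewrite lee_fin mulr_ge0// divr_ge0// ltW.
  rewrite muleA -EFinM /sharp_cost lee_wpmul2r// lee_fin.
  rewrite le_eqVlt; apply/orP; left; apply/eqP; field.
  by rewrite gt_eqF// dilation_factor_gt0.
rewrite /deviation -(fineK mufin) -/(deviation Q _).
rewrite -(fineK (deviation_qball_fin y (mean mu Q f) q0)) -!EFinM !lee_fin.
by rewrite mulrC ler_pdivlMl.
Qed.

Lemma oscillation_level_sharp (s : R) y : 0 <= s -> oscillation_level s y ->
  ((s / sharp_cost)%:E <= sharp_maximal d mu f y)%E.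
Proof.
move=> s0 [n /= hn yn]; apply: sharp_maximal_ge yn _ => //; exact: ltW.
Qed.

(** * Decay of averages *)

Variables p lambda : R.
Hypothesis p1 : 1 < p.
Hypothesis lambda_ltN : lambda < N.
Let theta := morrey_decay p lambda.
Let p0 : 0 < p. Proof. by apply: lt_trans p1. Qed.
Let theta_gt0 : 0 < theta. Proof. by rewrite divr_gt0// subr_gt0. Qed.

Variables (F D : R).
Hypothesis F0 : 0 <= F.
Hypothesis D0 : 0 < D.
Hypothesis morrey_f : forall x (r : R), 0 < r ->
  (\int[mu]_(y in B x r) (`|(f y)%:E| `^ p) <= (F * r `^ lambda)%:E)%E.
Hypothesis morrey_sharp : forall x (r : R), 0 < r ->
  (\int[mu]_(y in B x r) (`|sharp_maximal d mu f y| `^ p) <=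
   (D `^ p * r `^ lambda)%:E)%E.

Lemma powR_morrey_decay (r : R) : 0 < r ->
  (r `^ (- theta)) `^ p * r `^ N = r `^ lambda.
Proof.
move=> r0; have rn0 : r != 0 by rewrite gt_eqF.
rewrite -powRrM -powRD ?rn0 ?implybT//; congr (_ `^ _).
by rewrite /theta /morrey_decay; field; rewrite gt_eqF.
Qed.

Definition oscillation_constant : R := 2 * sharp_cost * C1 `^ (- p^-1).

Lemma oscillation_constant_gt0 : 0 < oscillation_constant.
Proof. by rewrite mulr_gt0 ?powR_gt0// mulr_gt0// sharp_cost_gt0. Qed.

(** Otherwise the sharp maximal function would exceed, on the whole ball, a constant
whose [p]-th power integrates to more than [D^p r^lambda]; the factor [2] in
[oscillation_constant] makes this strict. *)
Lemma oscillation_decay x (r : R) : 0 < r ->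
  (deviation (B x r) (mean mu (B x r) f) <=
   (oscillation_constant * D * r `^ (- theta))%:E * mu (B x r))%E.
Proof.
move=> r0; rewrite leNgt; apply/negP => /ltW large.
have e0 : 0 < r `^ (- theta) by exact: powR_gt0.
have c0 : 0 < C1 `^ (- p^-1) by exact: powR_gt0.
have sc0 := sharp_cost_gt0.
(* s^p * C1 * r^N is 2^p times the Morrey bound D^p * r^lambda *)
pose s := 2 * (D * C1 `^ (- p^-1) * r `^ (- theta)).
have s0 : 0 < s by rewrite mulr_gt0// !mulr_gt0.
have sharp_s y : B x r y -> (s%:E <= sharp_maximal d mu f y)%E.
  move=> xy; have -> : s = oscillation_constant * D * r `^ (- theta) / sharp_cost.
    by rewrite /s /oscillation_constant; field; rewrite gt_eqF.
  apply: sharp_maximal_ge xy large => //.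
  apply: mulr_ge0; last exact: powR_ge0.
  by apply: mulr_ge0; apply: ltW => //; exact: oscillation_constant_gt0.
have : ((s `^ p)%:E * mu (B x r) <= (D `^ p * r `^ lambda)%:E)%E.
  apply: le_trans (morrey_sharp x r0).
  rewrite -integral_cst//; apply: ge0_le_lower_integral => y By /=.
    by rewrite lee_fin powR_ge0.
  have sy := sharp_s y By.
  have sy0 : (0 <= sharp_maximal d mu f y)%E.
    by apply: le_trans sy; rewrite lee_fin ltW.
  rewrite gee0_abs// -poweR_EFin; apply: gt0_ler_poweR => //; first exact: ltW.
    by rewrite in_itv /= leey andbT lee_fin ltW.
  by rewrite in_itv /= leey andbT.
apply/negP; rewrite -ltNge.
apply: (@lt_le_trans _ _ ((s `^ p)%:E * (C1 * r `^ N)%:E)%E); last first.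
  rewrite lee_wpmul2l// ?lee_fin ?powR_ge0//; exact: (growth x r0).1.
have c0' := ltW c0; have e0' := ltW e0; have D0' := ltW D0.
have -> : s `^ p = 2 `^ p * (D `^ p * C1^-1 * (r `^ (- theta)) `^ p).
  rewrite /s !powRM ?mulr_ge0//; congr (_ * (_ * _ * _)).
  by rewrite -powRrM mulNr mulVf ?gt_eqF// powR_inv1// ltW.
rewrite -EFinM lte_fin.
have -> : 2 `^ p * (D `^ p * C1^-1 * (r `^ (- theta)) `^ p) * (C1 * r `^ N) =
    2 `^ p * (D `^ p * ((r `^ (- theta)) `^ p * r `^ N)).
  by field; rewrite gt_eqF.
rewrite powR_morrey_decay// ltr_pMl; last by rewrite mulr_gt0// powR_gt0.
by apply: powR_gt1 => //; rewrite ltr1n.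
Qed.

(** Chosen so that the estimate for one doubling is exactly the decrement
[T D (r^(-theta) - (2 r)^(-theta))] of a telescoping sum, with [T] this constant. *)
Definition telescoping_constant : R :=
  oscillation_constant * dilation_factor 2 * 2 `^ (- theta) / (1 - 2 `^ (- theta)).

Let q := 2 `^ (- theta).
Let q_gt0 : 0 < q. Proof. exact: powR_gt0. Qed.
Let q_lt1 : q < 1.
Proof.
rewrite /q powRN invf_lt1 ?powR_gt0//.
by apply: powR_gt1 => //; rewrite ltr1n.
Qed.

Lemma telescoping_constant_gt0 : 0 < telescoping_constant.
Proof.
apply: divr_gt0; last by rewrite subr_gt0.
apply: mulr_gt0; last exact: powR_gt0.
by apply: mulr_gt0; [exact: oscillation_constant_gt0|exact: dilation_factor_gt0].
Qed.

Lemma mean_doubling x (r : R) : 0 < r ->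
  `|mean mu (B x r) f - mean mu (B x (2 * r)) f| <=
  telescoping_constant * D * (1 - q) * r `^ (- theta).
Proof.
move=> r0; have r20 : 0 < 2 * r by rewrite mulr_gt0.
set a := mean mu (B x (2 * r)) f.
have mufin := measure_qball_fin x r0; have mu0 := measure_qball_gt0 x r0.
rewrite -lee_fin -(@lee_pmul2r _ (mu (B x r)))//.
apply: le_trans (mean_deviation x a r0) _.
have sub : B x r `<=` B x (2 * r) by apply: subset_qball; lra.
apply: le_trans (deviation_subset _ (mB _ _) (mB _ _) sub) _.
apply: le_trans (oscillation_decay x r20) _.
apply: le_trans (lee_wpmul2l _ (measure_qball_dilate x x r0 (ltr0n R 2))) _.
  rewrite lee_fin; apply: mulr_ge0; first apply: mulr_ge0.
  - exact: ltW oscillation_constant_gt0.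
  - exact: ltW.
  - exact: powR_ge0.
rewrite muleA -EFinM lee_wpmul2r// lee_fin powRM//; last exact: ltW.
rewrite le_eqVlt; apply/orP; left; apply/eqP.
rewrite /telescoping_constant -/q; field.
by rewrite subr_eq0 eq_sym lt_eqF.
Qed.

(** Telescope over the doubles of the ball; membership of [f] in the Morrey space
enters only through the mean over the last double, which the number of doublings
makes negligible, so that the bound [F] disappears. *)
Lemma mean_decay x (r : R) : 0 < r ->
  `|mean mu (B x r) f| <= 2 * telescoping_constant * D * r `^ (- theta).
Proof.
move=> r0; have T0 := telescoping_constant_gt0.
set T := telescoping_constant in T0 *; set e := r `^ (- theta).
have e0 : 0 < e by exact: powR_gt0.
have pow2 n : (2 ^+ n) `^ (- theta) = q ^+ n.
  rewrite -(powR_mulrn n (ltW q_gt0)) -(powR_mulrn n (ler0n R 2)) /q.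
  by rewrite -!(powRrM 2) mulrC.
have tele n : `|mean mu (B x r) f| <=
    `|mean mu (B x (2 ^+ n * r)) f| + T * D * (1 - q ^+ n) * e.
  elim: n => [|n IH]; first by rewrite !expr0 mul1r subrr mulr0 mul0r addr0.
  apply: le_trans IH _.
  have rn0 : 0 < 2 ^+ n * r by rewrite mulr_gt0// exprn_gt0.
  have := mean_doubling x rn0; rewrite mulrA -exprS powRM ?exprn_ge0 ?(ltW r0)//.
  rewrite -/T -/e pow2.
  have := ler_normD
    (mean mu (B x (2 ^+ n * r)) f - mean mu (B x (2 ^+ n.+1 * r)) f)
    (mean mu (B x (2 ^+ n.+1 * r)) f).
  rewrite subrK !exprS; set u := q ^+ n; move: `|_| `|_| `|_| => a b g.
  move=> h1 h2; have -> : T * D * (1 - q * u) * e = T * D * (1 - u) * e +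
    T * D * (1 - q) * (u * e) by ring.
  lra.
have far n : `|mean mu (B x (2 ^+ n * r)) f| <= (1 + F / C1) * (q ^+ n * e).
  have rn0 : 0 < 2 ^+ n * r by rewrite mulr_gt0// exprn_gt0.
  have mufin := measure_qball_fin x rn0; have mu0 := measure_qball_gt0 x rn0.
  have := mean_deviation x 0 rn0; rewrite subr0 => h.
  have := le_trans h (deviation_morrey p1 F0 rn0 (morrey_f x rn0)).
  rewrite lee_pmul2r// lee_fin -/theta powRM ?exprn_ge0 ?(ltW r0)//.
  by rewrite pow2.
have q1 : 1 < q^-1 by rewrite invf_gt1.
have [n hn] := powers_unbounded ((1 + F / C1) / (T * D)) q1.
have qn0 : 0 < q ^+ n by exact: exprn_gt0.
have TD0 : 0 < T * D by exact: mulr_gt0.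
have hn' : (1 + F / C1) * q ^+ n <= T * D.
  by move: hn; rewrite ler_pdivrMr// exprVn -ler_pdivlMr// [leRHS]mulrC.
apply: le_trans (tele n) _; apply: le_trans (lerD (far n) (lexx _)) _.
rewrite mulrA -mulrDl ler_pM2r//.
have : T * D * (1 - q ^+ n) <= T * D by rewrite ger_pMr//; lra.
lra.
Qed.

Definition average_constant : R := oscillation_constant + 2 * telescoping_constant.

Lemma average_constant_gt0 : 0 < average_constant.
Proof.
by rewrite addr_gt0 ?oscillation_constant_gt0// mulr_gt0// telescoping_constant_gt0.
Qed.

Lemma average_decay x (r : R) : 0 < r ->
  (deviation (B x r) 0 <= (average_constant * D * r `^ (- theta))%:E * mu (B x r))%E.
Proof.
move=> r0; apply: le_trans (deviation_shift 0 (mean mu (B x r) f) (mB _ _)) _.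
have e0 : 0 <= r `^ (- theta) by exact: powR_ge0.
have O0 := oscillation_constant_gt0; have T0 := telescoping_constant_gt0.
apply: (@le_trans _ _ ((oscillation_constant * D * r `^ (- theta))%:E * mu (B x r)
   + (2 * telescoping_constant * D * r `^ (- theta))%:E * mu (B x r))%E).
  apply: leeD; first exact: oscillation_decay.
  by rewrite lee_wpmul2r// lee_fin sub0r normrN mean_decay.
rewrite -ge0_muleDl ?lee_fin; last 2 first.
- by apply: mulr_ge0 => //; apply: mulr_ge0; exact: ltW.
- apply: mulr_ge0 => //; apply: mulr_ge0; last exact: ltW.
  by apply: mulr_ge0 => //; exact: ltW.
by rewrite /average_constant !mulrDl.
Qed.

(** * Integrals and sums over geometric levels *)

Let A := engulfing_cost.
Let a := 2 * A.
Let A_gt0 : 0 < A. Proof. exact: engulfing_cost_gt0. Qed.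

Lemma engulfing_cost_ge1 : 1 <= engulfing_cost.
Proof.
have C12 : C1 <= C2.
  have := le_trans (growth (c 0%N) ltr01).1 (growth (c 0%N) ltr01).2.
  by rewrite lee_fin powR1 !mulr1.
rewrite /engulfing_cost /dilation_factor -[leLHS]mulr1 ler_pM//.
  by rewrite ler_pdivlMr// mul1r.
apply/ltW/powR_gt1 => //; have := K1; lra.
Qed.
Let a_ge2 : 2 <= a.
Proof. by rewrite /a; have := engulfing_cost_ge1; rewrite -/A; lra. Qed.
Let a_gt0 : 0 < a. Proof. exact: lt_le_trans a_ge2. Qed.

Let a_gt1 : 1 < a. Proof. by have := a_ge2; lra. Qed.

(** A geometric sum with ratio at least 2 is at most twice its last term. *)
Lemma geometric_sum_le (s w : R) (P : pred nat) J : 0 < s -> 0 <= w ->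
  (forall j, P j -> a ^+ j * s <= w) ->
  \sum_(0 <= j < J | P j) (a ^+ j * s) `^ p <= 2 * w `^ p.
Proof.
move=> s0 w0 Pw.
have full n : \sum_(0 <= j < n.+1) (a ^+ j * s) `^ p <= 2 * (a ^+ n * s) `^ p.
  elim: n => [|n IH].
    rewrite big_nat1 ler_pMl// ?powR_gt0 ?mulr_gt0// ?exprn_gt0//; lra.
  rewrite big_nat_recr//= exprS -mulrA powRM ?(ltW a_gt0)//; last first.
    by rewrite mulr_ge0 ?exprn_ge0// ltW.
  have a2 : 2 <= a `^ p.
    by apply: le_trans a_ge2 _; apply: le1r_powR; exact: ltW.
  have v0 : 0 <= (a ^+ n * s) `^ p by exact: powR_ge0.
  by move: IH v0; move: (\sum_(_ <= _ < _) _) (_ `^ p) => u v; nra.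
elim: J => [|J IH]; first by rewrite big_geq// mulr_ge0// powR_ge0.
have [PJ|PJ] := boolP (P J); last first.
  by rewrite big_mkcond big_nat_recr//= (negbTE PJ) addr0 -big_mkcond.
apply: (@le_trans _ _ (\sum_(0 <= j < J.+1) (a ^+ j * s) `^ p)).
  by rewrite big_mkcond; apply: ler_sum => j _; case: ifP => // _; exact: powR_ge0.
apply: le_trans (full J) _; rewrite ler_pM2l// ge0_ler_powR ?nnegrE ?Pw ?(ltW p0)//.
by rewrite mulr_ge0 ?exprn_ge0// ltW.
Qed.

(** The factor [2^-1] from [geometric_sum_le] stands on the left because
constants are only moved out of integrals of measurable functions. *)
Lemma oscillation_levels_sum x (r s : R) J : 0 < r -> 0 < s ->
  (\sum_(0 <= j < J) (2^-1 * (a ^+ j * s) `^ p)%:E *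
     mu (B x r `&` oscillation_level (sharp_cost * (a ^+ j * s))) <=
   \int[mu]_(y in B x r) (`|sharp_maximal d mu f y| `^ p))%E.
Proof.
move=> r0 s0.
have as0 j : 0 < a ^+ j * s by rewrite mulr_gt0 ?exprn_gt0.
have w0 j : 0 <= 2^-1 * (a ^+ j * s) `^ p by rewrite mulr_ge0// powR_ge0.
pose O j := oscillation_level (sharp_cost * (a ^+ j * s)).
have mO j : measurable (O j) by exact: measurable_superlevel.
rewrite [leLHS](_ : _ = \int[mu]_(y in B x r) \sum_(0 <= j < J)
    ((2^-1 * (a ^+ j * s) `^ p)%:E * (\1_(O j) y)%:E))%E; last first.
  rewrite ge0_integral_sum//.
  - by apply: eq_bigr => j _; rewrite integral_weighted_indic.
  - by move=> j; exact: measurable_weighted_indic.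
  - by move=> j y _; rewrite mule_ge0// lee_fin.
apply: ge0_le_lower_integral => y By.
  by apply: sume_ge0 => j _; rewrite mule_ge0// lee_fin.
have sh0 : (0 <= sharp_maximal d mu f y)%E.
  apply: ereal_sup_ge; exists ((fine (mu (B y 1)))^-1%:E *
      deviation (B y 1) (mean mu (B y 1) f))%E; first by exists 1 => //=.
  by rewrite mule_ge0 ?deviation_ge0// lee_fin invr_ge0 fine_ge0.
have Osh j : O j y -> ((a ^+ j * s)%:E <= sharp_maximal d mu f y)%E.
  have sc0 := sharp_cost_gt0.
  have sj : 0 <= sharp_cost * (a ^+ j * s) by apply/ltW/mulr_gt0.
  move=> /(oscillation_level_sharp sj).
  by rewrite mulrAC mulfV ?gt_eqF// mul1r.
rewrite gee0_abs//; move: sh0 Osh.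
case: (sharp_maximal d mu f y) => [w| |] //; last first.
  by move=> _ _; rewrite poweRyr ?leey// gt_eqF.
rewrite lee_fin poweR_EFin => sh0 Osh.
under eq_bigr do rewrite -EFinM.
rewrite sumEFin lee_fin.
have := @geometric_sum_le s w (fun j => `[< O j y >]) J s0 sh0 _.
rewrite big_mkcond -ler_pdivrMl// mulr_sumr => h; apply: le_trans (h _) => //.
  apply: ler_sum => j _; rewrite indicE; case: asboolP => Oj.
    by rewrite mem_set// mulr1.
  by rewrite memNset// mulr0 mulr0.
by move=> j /asboolP /Osh; rewrite lee_fin.
Qed.

(** A discrete layer-cake estimate: a finite value of [M f] lies below the lowest
level or between two consecutive ones, and where [M f] is infinite so is the sum
over all levels. *)
Lemma maximal_integral_le x (r t : R) (M : \bar R) : 0 < r -> 0 < t ->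
  (forall J, (\sum_(0 <= j < J) ((a ^+ j * t) `^ p)%:E *
     mu (B x r `&` average_level (a ^+ j * t)) <= M)%E) ->
  (\int[mu]_(y in B x r) (`|maximal d mu f y| `^ p) <=
   ((A * a) `^ p)%:E * ((t `^ p)%:E * mu (B x r) + M))%E.
Proof.
move=> r0 t0 hM.
pose O j := average_level (a ^+ j * t).
have mO j : measurable (O j) by exact: measurable_superlevel.
pose G j y := (((a ^+ j * t) `^ p)%:E * (\1_(O j) y)%:E)%E.
have G0 j y : (0 <= G j y)%E by rewrite mule_ge0// lee_fin// powR_ge0.
have mG j : measurable_fun (B x r) (G j) by exact: measurable_weighted_indic.
have Gk k y : O k y -> (((a ^+ k * t) `^ p)%:E <= \sum_(0 <= j <oo) G j y)%E.
  move=> Oy; apply: le_trans (nneseries_lim_ge k.+1 _) => //.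
  rewrite big_nat_recr//= [X in (_ <= _ + X)%E](_ : _ = ((a ^+ k * t) `^ p)%:E).
    by rewrite leeDr// sume_ge0.
  by rewrite /G indicE mem_set// mule1.
apply: (@le_trans _ _ (\int[mu]_(y in B x r)
   (((A * a) `^ p)%:E * ((t `^ p)%:E + \sum_(0 <= j <oo) G j y)))%E); last first.
  rewrite ge0_integralZl//; last first.
  - by rewrite lee_fin powR_ge0.
  - by move=> y _; rewrite adde_ge0 ?nneseries_ge0// lee_fin powR_ge0.
  - by apply: emeasurable_funD => //; exact: ge0_emeasurable_sum.
  rewrite lee_wpmul2l// ?lee_fin ?powR_ge0// ge0_integralD//; last first.
  - exact: ge0_emeasurable_sum.
  - by move=> y _; rewrite nneseries_ge0.
  - by move=> y _; rewrite lee_fin powR_ge0.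
  rewrite (integral_cst _ _ (t `^ p)%:E)// leeD2l// integral_nneseries//.
  apply: lime_le.
    by apply: is_cvg_nneseries => j _ _; exact: integral_ge0.
  apply: nearW => J; apply: le_trans (hM J); apply: lee_sum => j _.
  by rewrite integral_weighted_indic// powR_ge0.
apply: ge0_le_lower_integral => y By; first exact: poweR_ge0.
have w0 : (0 <= maximal d mu f y)%E.
  apply: ereal_sup_ge; exists ((fine (mu (B y 1)))^-1%:E *
      \int[mu]_(z in B y 1) `|f z|%:E)%E; first by exists 1 => //=.
  by rewrite mule_ge0 ?integral_ge0// lee_fin invr_ge0 fine_ge0.
have wO j : ((A * (a ^+ j * t))%:E < maximal d mu f y)%E -> O j y.
  have sj : 0 <= A * (a ^+ j * t).
    exact: (ltW (mulr_gt0 A_gt0 (mulr_gt0 (exprn_gt0 j a_gt0) t0))).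
  move=> /(maximal_gt sj); rewrite /O.
  by rewrite -/A mulrAC mulfV ?gt_eqF// mul1r.
rewrite gee0_abs//; move: w0 wO.
case: (maximal d mu f y) => [w| |] //; last first.
  move=> _ wO; rewrite poweRyr ?gt_eqF//.
  suff -> : (\sum_(0 <= j <oo) G j y = +oo)%E.
    by rewrite addey// gt0_muley// lte_fin powR_gt0// mulr_gt0.
  apply/eqyP => m m0; have [k hk] := powers_unbounded ((1 + m) / t) a_gt1.
  apply: le_trans (Gk k y (wO k _)); last exact: ltry.
  move: hk; rewrite ler_pdivrMr// => hk; rewrite lee_fin.
  have u1 : 1 <= a ^+ k * t by lra.
  by apply: le_trans (le1r_powR u1 (ltW p1)); lra.
rewrite lee_fin poweR_EFin => w0 wO.
have S0 : (0 <= \sum_(0 <= j <oo) G j y)%E by exact: nneseries_ge0.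
have Aa0 : 0 <= A * a by rewrite ltW// mulr_gt0.
have main u : 0 <= u -> w <= A * a * u ->
    ((u `^ p)%:E <= (t `^ p)%:E + \sum_(0 <= j <oo) G j y)%E ->
    ((w `^ p)%:E <= ((A * a) `^ p)%:E *
       ((t `^ p)%:E + \sum_(0 <= j <oo) G j y))%E.
  move=> u0 wu hu.
  apply: le_trans (lee_wpmul2l _ hu); last by rewrite lee_fin powR_ge0.
  rewrite -EFinM lee_fin -powRM// ge0_ler_powR ?nnegrE ?(ltW p0)//.
  by rewrite mulr_ge0.
have exj : exists j, w <= A * (a ^+ j.+1 * t).
  have [k hk] := powers_unbounded (w / (A * t)) a_gt1.
  exists k; apply: le_trans (_ : A * (a ^+ k * t) <= _).
    by move: hk; rewrite (ler_pdivrMr _ _ (mulr_gt0 A_gt0 t0)) mulrCA.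
  rewrite ler_pM2l// ler_pM2r// exprS.
  by rewrite ler_peMl ?exprn_ge0 ?(ltW a_gt0) ?(ltW a_gt1).
case: (ex_minnP exj) => [[|k] hk kmin].
  apply: (main t); first exact: ltW.
    by move: hk; rewrite expr1 mulrA.
  by rewrite leeDl.
apply: (main (a ^+ k.+1 * t)); first by rewrite mulr_ge0 ?exprn_ge0// ltW.
  by move: hk; rewrite (exprS _ k.+1) !mulrA.
apply: le_trans (Gk k.+1 y (wO _ _)) _; last first.
  by rewrite leeDr// lee_fin powR_ge0.
rewrite lte_fin ltNge; apply/negP => /kmin.
by rewrite ltnn.
Qed.

(** * Absorption and the bound on one ball *)

(** Small enough both for [good_lambda] and for the absorption in [level_sum_le]. *)
Definition good_lambda_parameter : R :=
  (2 * (A + good_lambda_factor * a `^ p * kap `^ N))^-1.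

Let g := good_lambda_parameter.
Let eps := a `^ p * (good_lambda_factor * g).

Let gl_gt0 : 0 < good_lambda_factor * a `^ p * kap `^ N.
Proof.
apply: mulr_gt0; last exact: powR_gt0.
by apply: mulr_gt0; [exact: good_lambda_factor_gt0|exact: powR_gt0].
Qed.

Let g_gt0 : 0 < g.
Proof. by rewrite invr_gt0 mulr_gt0// addr_gt0. Qed.

Lemma good_lambda_parameter_cost : engulfing_cost * g <= 2^-1.
Proof.
rewrite /g /good_lambda_parameter -/A invfM mulrCA -[leRHS]mulr1 ler_pM2l//.
by rewrite ler_pdivrMr ?mul1r ?addr_gt0//; have := gl_gt0; lra.
Qed.

Lemma good_lambda_parameter_small : eps * kap `^ N <= 2^-1.
Proof.
have -> : eps * kap `^ N = good_lambda_factor * a `^ p * kap `^ N * g.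
  by rewrite /eps; ring.
rewrite /g /good_lambda_parameter; set G := _ * kap `^ N.
have G0 : 0 < G := gl_gt0.
rewrite invfM mulrCA -[leRHS]mulr1 ler_pM2l//.
by rewrite ler_pdivrMr ?mul1r ?addr_gt0//; have := A_gt0; lra.
Qed.

Definition oscillation_sum_constant : R :=
  2 * a `^ p * (sharp_cost / (g * A)) `^ p.

Let E := oscillation_sum_constant.
Let E_ge0 : 0 <= E.
Proof. by rewrite /E /oscillation_sum_constant !mulr_ge0// powR_ge0. Qed.

(** Each application of [good_lambda] moves down one level and dilates the ball, so
the claim is proved for all radii at least [R0] at a fixed base level [t].  The
lowest level contributes at most [t^p] times the measure of the ball, the
oscillation levels contribute an integral of the sharp maximal function, and the
remaining sum is multiplied by [eps] while [r^N] grows by [kap^N]. *)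
Lemma level_sum_le x (r R0 t : R) J : 0 < R0 -> R0 <= r -> 0 < t ->
  (forall y (s : R), R0 <= s -> (deviation (B y s) 0 <= t%:E * mu (B y s))%E) ->
  (\sum_(0 <= j < J) ((a ^+ j * t) `^ p)%:E *
     mu (B x r `&` average_level (a ^+ j * t)) <=
   (2 * C2 * t `^ p * r `^ N + 2 * E * D `^ p * r `^ lambda)%:E)%E.
Proof.
move=> R00 Rr t0 large.
have tp0 : 0 <= t `^ p by exact: powR_ge0.
have Dp0 : 0 <= D `^ p by exact: powR_ge0.
have C20' := ltW C20.
have eps0 : 0 <= eps.
  apply: mulr_ge0; first exact: powR_ge0.
  by apply: mulr_ge0; apply: ltW => //; exact: good_lambda_factor_gt0.
elim: J r Rr => [|J IH] r Rr.
  by rewrite big_geq// lee_fin addr_ge0// !mulr_ge0// powR_ge0.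
have r0 : 0 < r by exact: lt_le_trans Rr.
have sc0 := sharp_cost_gt0.
have gA0 : 0 < g * A by exact: mulr_gt0.
(* oscillation at the good-lambda level g * A * (a^j * t) forces the sharp
   maximal function above a^j * s *)
pose s := g * A / sharp_cost * t.
have s0 : 0 < s by apply: mulr_gt0 => //; exact: divr_gt0.
pose Om j := mu (B x (kap * r) `&` average_level (a ^+ j * t)).
pose Os j := mu (B x r `&` oscillation_level (sharp_cost * (a ^+ j * s))).
have step j : (((a ^+ j.+1 * t) `^ p)%:E *
     mu (B x r `&` average_level (a ^+ j.+1 * t)) <=
   eps%:E * (((a ^+ j * t) `^ p)%:E * Om j) +
   E%:E * ((2^-1 * (a ^+ j * s) `^ p)%:E * Os j))%E.
  have aj0 : 0 < a ^+ j by exact: exprn_gt0.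
  have aj1 : 1 <= a ^+ j by rewrite exprn_ege1// ltW.
  pose u := A * (a ^+ j * t).
  have u0 : 0 < u by do 2!apply: mulr_gt0 => //.
  have tu : t <= u.
    have := engulfing_cost_ge1; rewrite -/A /u => A1.
    have : t <= a ^+ j * t by rewrite ler_peMl// ltW.
    have : 0 < a ^+ j * t by exact: mulr_gt0.
    nra.
  have Rr' : R0 <= r by [].
  have largeu y v : R0 <= v -> (deviation (B y v) 0 <= u%:E * mu (B y v))%E.
    by move=> /(large y)/le_trans; apply; rewrite lee_wpmul2r// lee_fin.
  have := good_lambda x Rr' u0 g_gt0 good_lambda_parameter_cost largeu.
  rewrite -/A -/kap; have -> : 2 * u = a ^+ j.+1 * t.
    by rewrite /u exprS /a; ring.
  have -> : u / A = a ^+ j * t.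
    by rewrite /u mulrAC mulfV ?mul1r// gt_eqF.
  have -> : g * u = sharp_cost * (a ^+ j * s).
    by rewrite /u /s; field; rewrite gt_eqF.
  rewrite -/(Om j) -/(Os j) => gl.
  apply: le_trans (lee_wpmul2l _ gl) _; first by rewrite lee_fin powR_ge0.
  have glg0 : 0 <= good_lambda_factor * g.
    by apply: mulr_ge0; apply: ltW => //; exact: good_lambda_factor_gt0.
  rewrite ge0_muleDr ?measure_ge0//; last by rewrite mule_ge0// lee_fin.
  rewrite !muleA -!EFinM.
  have atp : (a ^+ j.+1 * t) `^ p = a `^ p * (a ^+ j * t) `^ p.
    rewrite exprS -mulrA powRM//; first exact: ltW.
    by apply: mulr_ge0; exact: ltW.
  have -> : (a ^+ j.+1 * t) `^ p * (good_lambda_factor * g) = eps * (a ^+ j * t) `^ p.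
    by rewrite atp /eps; ring.
  have -> // : (a ^+ j.+1 * t) `^ p = E * (2^-1 * (a ^+ j * s) `^ p).
  rewrite atp /E /oscillation_sum_constant.
  have -> : a ^+ j * t = sharp_cost / (g * A) * (a ^+ j * s).
    by rewrite /s; field; rewrite !gt_eqF.
  rewrite powRM; first by field.
    by rewrite divr_ge0// ltW.
  by apply: mulr_ge0; exact: ltW.
have bound0 j : (0 <= ((a ^+ j * t) `^ p)%:E * Om j)%E.
  by rewrite mule_ge0// lee_fin powR_ge0.
have bound1 j : (0 <= (2^-1 * (a ^+ j * s) `^ p)%:E * Os j)%E.
  by rewrite mule_ge0// lee_fin mulr_ge0// powR_ge0.
rewrite big_nat_recl//=.
have krR : R0 <= kap * r by apply: le_trans Rr _; have := kap_gt2; nra.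
have first : (((a ^+ 0 * t) `^ p)%:E *
    mu (B x r `&` average_level (a ^+ 0 * t)) <=
    (C2 * t `^ p * r `^ N)%:E)%E.
  rewrite expr0 mul1r.
  apply: (@le_trans _ _ ((t `^ p)%:E * (C2 * r `^ N)%:E)%E).
    rewrite lee_wpmul2l ?lee_fin//; apply: le_trans (growth x r0).2.
    apply: measure_subset => //; apply: measurableI => //.
    exact: measurable_superlevel.
  by rewrite -EFinM lee_fin mulrCA mulrA.
have osc := le_trans (oscillation_levels_sum x J r0 s0) (morrey_sharp x r0).
apply: le_trans (leeD first (lee_sum _ (fun j _ => step j))) _.
rewrite big_split/= -!ge0_sume_distrr//.
apply: le_trans (leeD (lexx _)
  (leeD (lee_wpmul2l _ (IH _ krR)) (lee_wpmul2l _ osc))) _.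
  by rewrite lee_fin.
  by rewrite lee_fin.
rewrite -!EFinM -!EFinD lee_fin.
have r0' := ltW r0; have kap0' := ltW kap_gt0.
rewrite (powRM N kap0' r0') (powRM lambda kap0' r0').
have kl : kap `^ lambda <= kap `^ N.
  by apply: ler_powR; [have := kap_gt2; lra|exact: ltW].
have h1 := good_lambda_parameter_small.
have h2 : eps * kap `^ lambda <= 2^-1 by apply: le_trans h1; rewrite ler_wpM2l.
have P0 : 0 <= C2 * t `^ p * r `^ N by rewrite !mulr_ge0// powR_ge0.
have Q0 : 0 <= E * D `^ p * r `^ lambda by rewrite !mulr_ge0// powR_ge0.
have PN := ler_wpM2l P0 h1; have QN := ler_wpM2l Q0 h2.
rewrite (_ : eps * _ = 2 * (C2 * t `^ p * r `^ N * (eps * kap `^ N)) +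
   2 * (E * D `^ p * r `^ lambda * (eps * kap `^ lambda))); last by ring.
rewrite (_ : E * (D `^ p * _) = E * D `^ p * r `^ lambda); last by ring.
rewrite (_ : 2 * C2 * _ * _ = 2 * (C2 * t `^ p * r `^ N)); last by ring.
rewrite (_ : 2 * E * _ * _ = 2 * (E * D `^ p * r `^ lambda)); last by ring.
lra.
Qed.

Definition maximal_constant : R :=
  (A * a) `^ p * (3 * C2 * average_constant `^ p + 2 * E).

(** With the base level at the value that averages over balls of radius at least [r]
cannot exceed, [t^p r^N] is a multiple of [D^p r^lambda]. *)
Lemma maximal_morrey_ball x (r : R) : 0 < r ->
  (\int[mu]_(y in B x r) (`|maximal d mu f y| `^ p) <=
   (maximal_constant * D `^ p * r `^ lambda)%:E)%E.
Proof.
move=> r0; pose t := average_constant * D * r `^ (- theta).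
have e0 : 0 < r `^ (- theta) by exact: powR_gt0.
have ac0 := average_constant_gt0.
have acD : 0 < average_constant * D by exact: mulr_gt0.
have t0 : 0 < t by exact: mulr_gt0.
have large y (s : R) : r <= s -> (deviation (B y s) 0 <= t%:E * mu (B y s))%E.
  move=> rs; have s0 : 0 < s by exact: lt_le_trans rs.
  apply: le_trans (average_decay y s0) _; rewrite lee_wpmul2r// lee_fin.
  rewrite /t ler_pM2l// !powRN lef_pV2 ?posrE ?powR_gt0//.
  by apply: ge0_ler_powR; rewrite ?nnegrE ?(ltW r0) ?(ltW s0) ?(ltW theta_gt0).
have h J := level_sum_le x J r0 (lexx r) t0 large.
apply: le_trans (maximal_integral_le r0 t0 h) _.
have tpr : t `^ p * r `^ N = average_constant `^ p * D `^ p * r `^ lambda.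
  have D0' := ltW D0; have ac0' := ltW ac0.
  rewrite /t powRM ?(ltW acD) ?(ltW e0)// powRM//.
  by rewrite -mulrA powR_morrey_decay.
have tp0 : 0 <= t `^ p by exact: powR_ge0.
apply: (@le_trans _ _ (((A * a) `^ p)%:E * ((t `^ p)%:E * (C2 * r `^ N)%:E +
  (2 * C2 * t `^ p * r `^ N + 2 * E * D `^ p * r `^ lambda)%:E))%E).
  rewrite lee_wpmul2l ?lee_fin ?powR_ge0// leeD2r// lee_wpmul2l ?lee_fin//.
  exact: (growth x r0).2.
rewrite -!EFinM lee_fin le_eqVlt; apply/orP; left; apply/eqP.
rewrite /maximal_constant; move: ((A * a) `^ p) E => u v.
rewrite -!mulrA; congr (_ * _).
rewrite (_ : t `^ p * (C2 * r `^ N) = C2 * (t `^ p * r `^ N)); last by ring.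
by rewrite tpr; ring.
Qed.

Lemma maximal_constant_gt0 : 0 < maximal_constant.
Proof.
apply: mulr_gt0; first by apply/powR_gt0/mulr_gt0.
apply: ltr_pwDl; last by rewrite mulr_ge0.
by rewrite !mulr_gt0// powR_gt0// average_constant_gt0.
Qed.

End fixed_function.

End ahlfors_regular.

(** * Morrey norms *)

Lemma morrey_norm_ge0 (R : realType) (disp : measure_display)
    (X : measurableType disp) (d : X -> X -> R) (mu : {measure set X -> \bar R})
    (p lambda : R) (g : X -> \bar R) (x0 : X) :
  (0 <= morrey_norm d mu p lambda g)%E.
Proof.
apply: (@le_trans _ _ (((1 `^ lambda)^-1%:E *
    \int[mu]_(y in qball d x0 1) (`|g y| `^ p)) `^ p^-1)%E).
  exact: poweR_ge0.
by apply: ereal_sup_ubound; exists (x0, 1) => //=.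
Qed.

Lemma morrey_norm_leP (R : realType) (disp : measure_display)
    (X : measurableType disp) (d : X -> X -> R) (mu : {measure set X -> \bar R})
    (p lambda D : R) (g : X -> \bar R) : 0 < p -> 0 <= D ->
  (morrey_norm d mu p lambda g <= D%:E)%E <->
  (forall x (r : R), 0 < r ->
    (\int[mu]_(y in qball d x r) (`|g y| `^ p) <= (D `^ p * r `^ lambda)%:E)%E).
Proof.
move=> p0 D0; have pn0 : p != 0 by rewrite gt_eqF.
have int0 x r : (0 <= \int[mu]_(y in qball d x r) (`|g y| `^ p))%E.
  by apply: integral_ge0 => y _; exact: poweR_ge0.
have root (r : R) (u : \bar R) : 0 < r -> (0 <= u)%E ->
    ((((r `^ lambda)^-1%:E * u) `^ p^-1 <= D%:E)%E <->
     (u <= (D `^ p * r `^ lambda)%:E)%E).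
  move=> r0 u0; have rl0 : 0 < r `^ lambda by exact: powR_gt0.
  have v0 : (0 <= (r `^ lambda)^-1%:E * u)%E.
    by rewrite mule_ge0// lee_fin invr_ge0 ltW.
  have -> : (u <= (D `^ p * r `^ lambda)%:E)%E =
      ((r `^ lambda)^-1%:E * u <= (D `^ p)%:E)%E.
    by rewrite muleC lee_pdivrMr// EFinM.
  move: v0; move: (_ * u)%E => [v| |]// v0; last first.
    by rewrite poweRyr ?invr_neq0// leye_eq.
  rewrite poweR_EFin !lee_fin; split => h.
    have := ge0_ler_powR (ltW p0); move/(_ (v `^ p^-1) D).
    rewrite !nnegrE powR_ge0 => /(_ isT D0 h).
    by rewrite -powRrM mulVf// powRr1.
  have pv0 : 0 <= p^-1 by rewrite invr_ge0 ltW.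
  have := ge0_ler_powR pv0; move/(_ v (D `^ p)).
  rewrite !nnegrE powR_ge0 => /(_ v0 isT h).
  by rewrite -powRrM mulfV// powRr1.
split=> [h x r r0|h].
  apply/root => //; apply: le_trans h; apply: ereal_sup_ubound.
  by exists (x, r).
apply: ge_ereal_sup => _ [[x r] /= r0 <-].
by apply/root => //; exact: h.
Qed.

Theorem lemma5p3 (R : realType) (disp : measure_display)
    (X : measurableType disp) (d : X -> X -> R)
    (mu : {measure set X -> \bar R})
    (hX : homogeneous_space d mu) (hmuX : mu [set: X] = +oo%E)
    (N C1 C2 : R) (hN : 0 < N) (hC1 : 0 < C1) (hC2 : 0 < C2)
    (hgrowth : forall (x : X) (r : R), 0 < r ->
       ((C1 * r `^ N)%:E <= mu (qball d x r))%E /\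
       (mu (qball d x r) <= (C2 * r `^ N)%:E)%E)
    (p lambda : R) (hp : 1 < p) (hlambda0 : 0 <= lambda) (hlambdaN : lambda < N) :
  exists C : R, 0 < C /\
    forall f : X -> R, morrey_space d mu p lambda f ->
      (morrey_norm d mu p lambda (maximal d mu f) <=
       C%:E * morrey_norm d mu p lambda (sharp_maximal d mu f))%E.
Proof.
have [[dge0 d0 dC [K0 hK0]] mB _] := hX.
have d00 x : d x x = 0 by exact/d0.
(* a triangle constant may be enlarged; covering needs it to be at least 1 *)
pose K := Num.max K0 1.
have K1 : 1 <= K by rewrite le_max lexx orbT.
have dK x y z : d x z <= K * (d x y + d y z).
  apply: le_trans (hK0 x y z) _; rewrite ler_wpM2r ?addr_ge0//.
  by rewrite le_max lexx.
have [x0 _] : [set: X] !=set0.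
  by apply/set0P/eqP => X0; move: hmuX; rewrite X0 measure0.
have [c [rho [rho0 cP]]] := engulfing_sequence d00 dC K1 dK mB hC1 hgrowth x0.
have M0 := maximal_constant_gt0 K1 hN hC1 hC2 hgrowth c hp hlambdaN.
set M := maximal_constant K N C1 C2 p lambda in M0.
pose C := M `^ p^-1.
have C0 : 0 < C by exact: powR_gt0.
have p0 : 0 < p by exact: lt_trans hp.
exists C; split => // f [mf fin_f].
have [F F0 morrey_f] : exists2 F : R, 0 <= F & forall x (r : R), 0 < r ->
    (\int[mu]_(y in qball d x r) (`|(f y)%:E| `^ p) <= (F * r `^ lambda)%:E)%E.
  have Nf0 := morrey_norm_ge0 d mu p lambda (EFin \o f) x0.
  have Nf : morrey_norm d mu p lambda (EFin \o f) \is a fin_num.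
    by rewrite ge0_fin_numE.
  exists (fine (morrey_norm d mu p lambda (EFin \o f)) `^ p); first exact: powR_ge0.
  by apply/morrey_norm_leP; rewrite ?fine_ge0// fineK.
have locf x (r : R) : 0 < r -> (deviation mu f (qball d x r) 0 < +oo)%E.
  move=> r0; apply: le_lt_trans
    (deviation_morrey mB hC1 hgrowth mf hp F0 r0 (morrey_f x r r0)) _.
  by rewrite -(fineK (measure_qball_fin hgrowth x r0)) -EFinM ltry.
have S0 := morrey_norm_ge0 d mu p lambda (sharp_maximal d mu f) x0.
have [Sy|Sfin] := eqVneq (morrey_norm d mu p lambda (sharp_maximal d mu f)) +oo%E.
  by rewrite Sy gt0_muley ?leey.
have Sf : morrey_norm d mu p lambda (sharp_maximal d mu f) \is a fin_num.
  by rewrite ge0_fin_numE// lt_neqAle Sfin leey.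
apply/lee_addgt0Pr => e e0.
(* the slack e / C keeps D positive when the sharp maximal norm vanishes *)
pose D := fine (morrey_norm d mu p lambda (sharp_maximal d mu f)) + e / C.
have D0 : 0 < D by rewrite ltr_wpDl ?fine_ge0// divr_gt0.
have -> : (C%:E * morrey_norm d mu p lambda (sharp_maximal d mu f) + e%:E)%E =
    (C * D)%:E.
  rewrite -{1}(fineK Sf) -EFinM -EFinD mulrDr; congr (_ + _)%:E.
  by rewrite mulrCA mulfV ?mulr1// gt_eqF.
have sharp_D : (morrey_norm d mu p lambda (sharp_maximal d mu f) <= D%:E)%E.
  by rewrite -{1}(fineK Sf) lee_fin lerDl ltW// divr_gt0.
apply/morrey_norm_leP => //; first by apply: mulr_ge0; exact: ltW.
move=> x r r0; rewrite powRM ?(ltW C0) ?(ltW D0)// -powRrM mulVf ?gt_eqF//.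
rewrite powRr1 ?(ltW M0)//.
apply: (maximal_morrey_ball d00 dC K1 dK mB hN hC1 hC2 hgrowth mf locf rho0 cP
  hp hlambdaN F0 D0 morrey_f _ x r0).
by apply/morrey_norm_leP => //; exact: ltW.
Qed.
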